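(* Let $X \subseteq \mathbb{R}^n$ be a simple closed uniformly polynomially cuspidal (UPC) set and let $d := d(X)$. Then $$\mathscr{C}^\omega_{1,d}(X) \cap \mathcal{C}^\infty|_X = \mathcal{C}^\omega|_X.$$
   Context: Let $X \subseteq \mathbb{R}^n$ be nonempty; $X^\circ$ denotes its interior and $\partial X$ its boundary. Plots: for positive integers $m,d$, an $(m,d)$-plot in $X$ is the germ at $0$ of a polynomial map $p=(p_1,\ldots,p_n):\mathbb{R}^m\to\mathbb{R}^n$ of degree at most $d$ (i.e. $\max_i \deg p_i\le d$) such that $p(U)\subseteq X$ for some neighborhood $U$ of $0$ in $\mathbb{R}^m$. $\mathcal{P}_{m,d}(X)$ is the set of all $(m,d)$-plots in $X$. $\mathscr{C}^\omega_{m,d}(X)$ is the set of all functions $f:X\to\mathbb{R}$ (no continuity assumed) such that $f\circ p$ is a real analytic germ at $0\in\mathbb{R}^m$ for all $p\in\mathcal{P}_{m,d}(X)$. For closed $X$, $\mathcal{C}^\omega|_X$ (resp. $\mathcal{C}^\infty|_X$) is the set of all functions $f:X\to\mathbb{R}$ for which there exist an open neighborhood $U$ of $X$ in $\mathbb{R}^n$ and a real analytic (resp. smooth, i.e. $C^\infty$) function $F:U\to\mathbb{R}$ with $F|_X=f$. UPC sets: a closed set $X\subseteq\mathbb{R}^n$ is uniformly polynomially cuspidal (UPC) if there exist positive integers $m,D$ and a constant $M>0$ such that for each $x\in X$ there is a polynomial curve $h_x:\mathbb{R}\to\mathbb{R}^n$ of degree at most $D$ with (1) $h_x(0)=x$,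 and (2) $\operatorname{dist}(h_x(t),\mathbb{R}^n\setminus X)\ge M t^m$ for all $x\in X$ and $t\in[0,1]$. In that case $X$ is said to have the characteristic $(m,D)$. $\operatorname{char}(X)$ is the set of all characteristics of $X$, and $$d(X):=2\min_{(m,D)\in\operatorname{char}(X)}\max\{m,D\}.$$ $X$ is simple if each $x\in\partial X$ has a basis of neighborhoods $\mathscr{U}$ such that $U\cap X^\circ$ is connected for all $U\in\mathscr{U}$. *)

(* Defs.v *)
From HB Require Import structures.
From mathcomp Require Import all_boot all_order all_algebra.
From mathcomp Require Import all_classical all_reals all_analysis.
(* Not imported: the notations of mpoly clash with those of analysis, and
   summability.summable would shadow esum.summable. *)
From mathcomp Require mpoly summability.
Import (canonicals, coercions) mpoly.

Set Implicit Arguments.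
Unset Strict Implicit.
Unset Printing Implicit Defensive.

Import Order.TTheory GRing.Theory Num.Theory.
Import numFieldNormedType.Exports.

Local Open Scope classical_set_scope.
Local Open Scope ring_scope.

Section Analytic.
Context {R : realType} {n : nat}.
Implicit Types (F : 'rV[R]_n -> R) (a x : 'rV[R]_n) (U : set 'rV[R]_n).

Definition monom (k : mpoly.multinom n) (x : 'rV[R]_n) : R :=
  \prod_(i < n) x 0 i ^+ mpoly.fun_of_multinom k i.

(* The sum over multi-indices is unordered: it is the limit of the net of
   finite partial sums, i.e. the multivariate power series converges
   absolutely. *)
Definition real_analytic_at F a :=
  exists c : mpoly.multinom n -> R, \forall x \near a,
    summability.partial_sum (fun k => c k * monom k (x - a)) A
      @[A --> summability.totally] --> F x.

Definition real_analytic_on U F := forall a, U a -> real_analytic_at F a.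

(* [:: i1; ...; ik] stands for the partial derivative d/dx_i1 ... d/dx_ik. *)
Definition iter_partial (s : seq 'I_n) F : 'rV[R]_n -> R :=
  foldr (fun i G => fun x => 'D_(delta_mx 0 i) G x) F s.

(* Meant for U open, so that derivatives at points of U only depend on the
   values of F on U. Derivability is stated separately because 'D_v is total. *)
Definition smooth_on U F := forall (s : seq 'I_n) x, U x ->
  {for x, continuous (iter_partial s F)} /\
  forall i, derivable (iter_partial s F) x (delta_mx 0 i).

End Analytic.

Section Plots.
Context {R : realType} {n : nat}.
Implicit Type X : set 'rV[R]_n.

Definition poly_map {m} (p : 'I_n -> mpoly.mpoly m R) (t : 'rV[R]_m) : 'rV[R]_n :=
  \row_i mpoly.meval (fun j => t 0 j) (p i).

(* A polynomial map is determined by its germ at 0, so plots are represented by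
   polynomials rather than by germs; msize is 1 + degree. *)
Definition plots (m d : nat) X : set ('I_n -> mpoly.mpoly m R) :=
  [set p | (forall i, (mpoly.msize (p i) <= d.+1)%N) /\
           \forall t \near (0 : 'rV[R]_m), X (poly_map p t)].

(* The germ of f \o p at 0 is the germ of g; since X (poly_map p t) holds for t
   near 0, the point z below exists (and is unique) for such t. *)
Definition plot_analytic (m d : nat) X : set (X -> R) :=
  [set f | forall p : 'I_n -> mpoly.mpoly m R, plots d X p ->
     exists2 g : 'rV[R]_m -> R, real_analytic_at g 0 &
       \forall t \near (0 : 'rV[R]_m),
         forall z : X, val z = poly_map p t -> f z = g t].

Definition analytic_restr X : set (X -> R) :=
  [set f | exists U : set 'rV[R]_n, exists F : 'rV[R]_n -> R,
    [/\ open U, X `<=` U, real_analytic_on U F & forall z : X, F (val z) = f z]].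

Definition smooth_restr X : set (X -> R) :=
  [set f | exists U : set 'rV[R]_n, exists F : 'rV[R]_n -> R,
    [/\ open U, X `<=` U, smooth_on U F & forall z : X, F (val z) = f z]].

End Plots.

Arguments plots {R n} m d X p : rename.
Arguments plot_analytic {R n} m d X f : rename.
Arguments analytic_restr {R n} X f : rename.
Arguments smooth_restr {R n} X f : rename.

Section UPC.
Context {R : realType} {n : nat}.
Implicit Type X : set 'rV[R]_n.

(* The library norm on 'rV[R]_n is the sup norm. *)
Definition euclidean_norm (x : 'rV[R]_n) : R := Num.sqrt (\sum_(i < n) x 0 i ^+ 2).

(* +oo when A is empty *)
Definition euclidean_dist (x : 'rV[R]_n) (A : set 'rV[R]_n) : \bar R :=
  ereal_inf [set (euclidean_norm (x - y))%:E | y in A].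

Definition poly_curve (h : 'I_n -> {poly R}) (t : R) : 'rV[R]_n :=
  \row_i (h i).[t].

Definition char X : set (nat * nat) :=
  [set mD | [/\ (0 < mD.1)%N, (0 < mD.2)%N &
    exists2 M : R, 0 < M & forall x, X x ->
      exists h : 'I_n -> {poly R},
        [/\ (forall i, (size (h i) <= mD.2.+1)%N),
            poly_curve h 0 = x &
            forall t : R, t \in `[0, 1] ->
              ((M * t ^+ mD.1)%:E <= euclidean_dist (poly_curve h t) (~` X))%E]]].

Definition UPC X := closed X /\ char X !=set0.

End UPC.

Definition minimum (A : set nat) : nat := xget 0%N (A `&` lbound A).

Lemma minimumP (A : set nat) : A !=set0 -> A (minimum A) /\ lbound A (minimum A).
Proof.
case=> k Ak; have exA : exists k, `[< A k >] by exists k; exact/asboolP.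
case: (ex_minnP exA) => j /asboolP Aj minj.
rewrite /minimum; case: xgetP => [i _ []//|/(_ j) []].
by split=> // i /asboolP /minj.
Qed.

Definition d_of {R : realType} {n : nat} (X : set 'rV[R]_n) : nat :=
  2 * minimum [set maxn mD.1 mD.2 | mD in char X].

Definition boundary {T : topologicalType} (X : set T) : set T :=
  closure X `\` interior X.

Definition nbhs_basis {T : topologicalType} (x : T) (B : set (set T)) :=
  (forall U, B U -> nbhs x U) /\
  (forall V, nbhs x V -> exists2 U, B U & U `<=` V).

Definition simple {T : topologicalType} (X : set T) :=
  forall x, boundary X x -> exists2 B : set (set T), nbhs_basis x B &
    forall U, B U -> connected (U `&` interior X).

(* Main.v *)
Require Import Defs.
From HB Require Import structures.
From mathcomp Require Import all_boot all_order all_algebra finmap.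
From mathcomp Require Import all_classical all_reals all_analysis.
From mathcomp Require Import ring lra zify.
From mathcomp Require mpoly summability.
Import -(notations) mpoly.
Import numFieldNormedType.Exports.
Import Order.TTheory GRing.Theory Num.Theory.

Set Implicit Arguments.
Unset Strict Implicit.
Unset Printing Implicit Defensive.

Local Open Scope classical_set_scope.
Local Open Scope ring_scope.

(** Analytic functions on X have the two properties because power series may be
    differentiated term by term and composed with polynomials. Conversely, let F be
    smooth near X and analytic along the polynomial curves in X of degree at most
    d = 2 max (m, D), where (m, D) is a characteristic of X.

    Let x be a point of X and h a curve of degree at most D with h 0 = x and
    dist (h t, complement of X) >= M t ^ m. For v in a small ball the curves
    p_v (t) = h (t ^ 2) + t ^ (2 m) v are plots of degree at most d
    ([char_cusp_curve]), and so each function F (p_v (t)) is analytic at t = 0. By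
    Baire's theorem its Taylor coefficients c_k (v) are O(N ^ k) with the same N for
    all v in some ball. Now the derivatives of F of order j at x appear in c_k (v)
    with k = 2 m j, as the terms of degree j in v, which is the top degree;
    iterated differences in v isolate them and give Cauchy estimates
    |d_s F (x)| <= C (L j) ^ j for |s| = j ([cauchy_estimates]). In the proof
    the coefficients c_k are replaced by finite differences in t: these depend
    continuously on v because F is continuous.

    Hence the Taylor series of F at x converges to an analytic function T near x
    ([taylor_series_ex]), and F - T is flat at x. Along p_v the function F - T is both
    analytic and flat at 0, so that it vanishes for small t, uniformly in v
    ([vanish_cusp]): F = T on a ball in the interior of X, arbitrarily close to x. The
    interior of X is connected near x because X is simple, and F - T is analytic
    along segments in it, so F = T on the interior near x, and then on X near x, as the
    interior is dense in X ([local_extension]). The identity principle glues the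
    functions T for varying x ([global_extension]).

    Analyticity is handled throughout in the form of series of polynomials converging
    normally for a weighted l1 norm ([normal_expansion]), which substitution of
    polynomials preserves ([pnorm_comp]). *)

(** * Weighted l1 norms of polynomials *)

Section PNorm.
Context {R : realType} {n : nat}.
Implicit Types (p q : mpoly n R) (r : R) (m : multinom n).

(** The norm attached to the polydisc of radius r: it bounds p on |z| <= r,
    is submultiplicative, and therefore behaves well under composition. *)
Definition pnorm r p : R := \sum_(m <- msupp p) `|mcoeff m p| * r ^+ mdeg m.

Lemma pnormE (s : seq (multinom n)) r p : uniq s -> {subset msupp p <= s} ->
  pnorm r p = \sum_(m <- s) `|mcoeff m p| * r ^+ mdeg m.
Proof.
move=> us sub; rewrite (bigID (mem (msupp p)))/= [X in _ + X]big1 ?addr0; last first.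
  by move=> m /memN_msupp_eq0 ->; rewrite normr0 mul0r.
rewrite -big_filter; apply: perm_big; apply: uniq_perm.
- exact: msupp_uniq.
- exact: filter_uniq.
- by move=> m; rewrite mem_filter /=; case: (boolP (m \in msupp p)) => // /sub ->.
Qed.

Lemma pnorm_ge0 r p : 0 <= r -> 0 <= pnorm r p.
Proof. by move=> r0; apply: sumr_ge0 => m _; rewrite mulr_ge0 ?exprn_ge0. Qed.

Lemma pnormD r p q : 0 <= r -> pnorm r (p + q) <= pnorm r p + pnorm r q.
Proof.
move=> r0; pose s := undup (msupp p ++ msupp q ++ msupp (p + q)).
have us : uniq s by exact: undup_uniq.
rewrite !(@pnormE s) // -?big_split /=; first last.
- by move=> m mp; rewrite mem_undup !mem_cat mp ?orbT.
- by move=> m mp; rewrite mem_undup !mem_cat mp ?orbT.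
- by move=> m mp; rewrite mem_undup !mem_cat mp ?orbT.
apply: ler_sum => m _; rewrite -mulrDl mcoeffD.
by rewrite ler_wpM2r ?exprn_ge0 ?ler_normD.
Qed.

Lemma pnorm0 r : pnorm r 0 = 0.
Proof. by rewrite /pnorm msupp0 big_nil. Qed.

Lemma pnormZ r (c : R) p : pnorm r (c *: p) = `|c| * pnorm r p.
Proof.
rewrite (@pnormE (msupp p)) ?msupp_uniq //; last exact: msuppZ_le.
by rewrite mulr_sumr; apply: eq_bigr => m _; rewrite mcoeffZ normrM mulrA.
Qed.

Lemma pnorm_sum r I (s : seq I) (P : pred I) (F : I -> mpoly n R) : 0 <= r ->
  pnorm r (\sum_(i <- s | P i) F i) <= \sum_(i <- s | P i) pnorm r (F i).
Proof.
move=> r0; elim/big_ind2 : _ => [|a b c d ab cd|//]; first by rewrite pnorm0.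
by rewrite (le_trans (pnormD _ _ r0)) ?lerD.
Qed.

Lemma pnormX r m : pnorm r (mpolyX R m) = r ^+ mdeg m.
Proof. by rewrite /pnorm msuppX big_seq1 mcoeffX eqxx normr1 mul1r. Qed.

Lemma pnorm1 r : pnorm r 1 = 1.
Proof. by rewrite -mpolyX0 pnormX mdeg0 expr0. Qed.

Lemma pnormC r (c : R) : pnorm r (mpolyC n c) = `|c|.
Proof. by rewrite -alg_mpolyC pnormZ pnorm1 mulr1. Qed.

Lemma pnormM r p q : 0 <= r -> pnorm r (p * q) <= pnorm r p * pnorm r q.
Proof.
move=> r0; rewrite mpolyME (le_trans (pnorm_sum _ _ _ r0)) //.
rewrite big_allpairs_dep /= /pnorm mulr_suml.
apply: ler_sum => m _; rewrite mulr_sumr; apply: ler_sum => m' _.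
by rewrite -!/(pnorm _ _) pnormZ pnormX mdegD normrM exprD mulrACA.
Qed.

Lemma pnormXn r p k : 0 <= r -> pnorm r (p ^+ k) <= pnorm r p ^+ k.
Proof.
move=> r0; elim: k => [|k IH]; first by rewrite !expr0 pnorm1.
by rewrite !exprS (le_trans (pnormM _ _ r0)) // ler_wpM2l ?pnorm_ge0.
Qed.

Lemma pnorm_prod r I (s : seq I) (P : pred I) (F : I -> mpoly n R) : 0 <= r ->
  pnorm r (\prod_(i <- s | P i) F i) <= \prod_(i <- s | P i) pnorm r (F i).
Proof.
move=> r0; elim/big_rec2 : _ => [|i a b _ ab]; first by rewrite pnorm1.
by rewrite (le_trans (pnormM _ _ r0)) // ler_wpM2l ?pnorm_ge0.
Qed.

Definition ev (z : 'rV[R]_n) p : R := meval (fun j => z 0 j) p.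

Lemma norm_coord_le (z : 'rV[R]_n) i : `|z 0 i| <= `|z|.
Proof. by rewrite [leRHS]/Num.norm/= mx_normrE; apply: (le_bigmax _ _ (0, i)). Qed.

Lemma norm_le_coord (z : 'rV[R]_n) r : 0 <= r -> (forall i, `|z 0 i| <= r) -> `|z| <= r.
Proof.
move=> r0 zr; rewrite [leLHS]/Num.norm/= mx_normrE; apply/bigmax_leP; split=> // -[i j] _ /=.
by rewrite ord1.
Qed.

Lemma norm_lt_coord (z : 'rV[R]_n) r : 0 < r -> (forall i, `|z 0 i| < r) -> `|z| < r.
Proof.
move=> r0 zr; rewrite [ltLHS]/Num.norm/= mx_normrE; apply/bigmax_ltP; split=> // -[i j] _ /=.
by rewrite ord1.
Qed.

Lemma monom_le (z : 'rV[R]_n) m r : `|z| <= r -> `|monom m z| <= r ^+ mdeg m.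
Proof.
move=> zr; rewrite /monom normr_prod mdegE -prodrXr; apply: ler_prod => i _.
have zi : `|z 0 i| <= r by exact: le_trans (norm_coord_le _ _) zr.
by rewrite normr_ge0 normrX lerXn2r ?nnegrE // (le_trans _ zi).
Qed.

Lemma evE (z : 'rV[R]_n) p : ev z p = \sum_(m <- msupp p) mcoeff m p * monom m z.
Proof. exact: mevalE. Qed.

Lemma ev_le (z : 'rV[R]_n) p r : `|z| <= r -> `|ev z p| <= pnorm r p.
Proof.
move=> zr; rewrite evE (le_trans (ler_norm_sum _ _ _)) //.
by apply: ler_sum => m _; rewrite normrM ler_wpM2l ?monom_le.
Qed.

End PNorm.

(** Substituting polynomials of norm at most r into p costs nothing: this is what
    makes re-expansion at another point and composition with a polynomial curve
    the same, immediate operation on normally convergent series. *)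
Lemma pnorm_comp (R : realType) n k (r s : R) (p : mpoly n R)
    (q : n.-tuple (mpoly k R)) : 0 <= s ->
  (forall i, pnorm s (tnth q i) <= r) -> pnorm s (comp_mpoly q p) <= pnorm r p.
Proof.
move=> s0 qr; rewrite comp_mpolyE (le_trans (pnorm_sum _ _ _ s0)) //.
apply: ler_sum => m _; rewrite pnormZ ler_wpM2l //.
rewrite (le_trans (pnorm_prod _ _ _ s0)) // mdegE -prodrXr; apply: ler_prod => i _.
rewrite pnorm_ge0 // (le_trans (pnormXn _ _ s0)) // lerXn2r ?nnegrE ?pnorm_ge0 //.
exact: le_trans (pnorm_ge0 _ s0) (qr i).
Qed.

(** * Geometric series and unordered sums *)

Section Series.
Context {R : realType}.

(** Completeness in the only form needed: a series dominated by a geometric one has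
    a sum, together with the rate of convergence. The sum is the supremum of the
    partial sums diminished by the bound on the tail, which increase. *)
Lemma geometric_sum_ex (u : nat -> R) (C : R) : (forall j, `|u j| <= C / 2 ^+ j) ->
  exists l, forall N, `|l - \sum_(j < N) u j| <= 2 * C / 2 ^+ N.
Proof.
move=> uC; pose S N := \sum_(j < N) u j; pose T N := 2 * C / 2 ^+ N.
have TS N : T N.+1 = T N - C / 2 ^+ N.
  by rewrite /T exprS; field; rewrite expf_neq0.
have low N : S N - T N <= S N.+1 - T N.+1.
  rewrite /S big_ord_recr /= TS.
  by have := uC N; rewrite ler_norml => /andP[]; lra.
have upp N : S N.+1 + T N.+1 <= S N + T N.
  rewrite /S big_ord_recr /= TS.
  by have := uC N; rewrite ler_norml => /andP[]; lra.
have T0 N : 0 <= T N.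
  rewrite /T -mulrA mulr_ge0 //; exact: le_trans (normr_ge0 _) (uC N).
have key N K : S N - T N <= S K + T K.
  have lowm : {homo (fun N => S N - T N) : i j / (i <= j)%N >-> i <= j}.
    by apply: homo_leq => [//|y x z|//]; exact: le_trans.
  have uppm : {homo (fun N => S N + T N) : i j / (i <= j)%N >-> j <= i}.
    by apply: homo_leq => [//|y x z /[swap]|//]; exact: le_trans.
  have := lowm _ _ (leq_maxl N K); have := uppm _ _ (leq_maxr N K) => /=.
  by have := T0 (maxn N K); lra.
exists (sup [set S N - T N | N in setT]) => N.
have hs : has_sup [set S N - T N | N in setT].
  split; first by exists (S 0%N - T 0%N), 0%N.
  by exists (S 0%N + T 0%N) => _ [K _ <-].
rewrite ler_distl; apply/andP; split.
  by apply: (sup_upper_bound hs); exists N.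
apply: (sup_le_ub (proj1 hs)) => _ [K _ <-]; have := key K N; rewrite /S /T; lra.
Qed.

Lemma cvg_totallyP (I : choiceType) (a : I -> R) (l : R) :
  summability.partial_sum a A @[A --> summability.totally] --> l <->
  forall e, 0 < e -> exists J0 : {fset I}, forall J : {fset I},
    (J0 `<=` J)%fset -> `|l - \sum_(i <- J) a i| < e.
Proof.
have FF := @summability.totally_filter I.
have E (J : {fset I}) : summability.partial_sum a J = \sum_(i <- J) a i.
  by rewrite /summability.partial_sum big_seq_fsetE.
split=> [/cvgrPdist_lt al e e0|H].
  have [J0 _ J0P] := al e e0; exists J0 => J JJ; rewrite -E; exact: J0P.
apply/cvgrPdist_lt => e e0; have [J0 J0P] := H e e0.
by exists J0 => // J /= JJ; rewrite E; exact: J0P.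
Qed.

(** Unordered convergence forces absolute convergence: beyond a finite set J0 the
    sums over the indices of each sign stay bounded. *)
Lemma cvg_totally_bounded (I : choiceType) (a : I -> R) (l : R) :
  summability.partial_sum a A @[A --> summability.totally] --> l ->
  exists B, forall J : {fset I}, \sum_(i <- J) `|a i| <= B.
Proof.
move=> /cvg_totallyP/(_ 1 ltr01)[J0 J0P].
exists (\sum_(i <- J0) `|a i| + 4) => J.
(* Both the sum over J0 and the sum over J0 and K are within 1 of l. *)
have part (P : pred I) : `|\sum_(i <- J | (i \notin J0) && P i) a i| <= 2.
  pose K := [fset i in J | (i \notin J0) && P i]%fset.
  have KE : \sum_(i <- K) a i = \sum_(i <- J | (i \notin J0) && P i) a i.
    rewrite -[RHS]big_filter; apply: perm_big; apply: uniq_perm.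
    - exact: fset_uniq.
    - by rewrite filter_uniq // fset_uniq.
    - by move=> i; rewrite mem_filter !inE /= andbC.
  have := J0P _ (fsubsetUl J0 K).
  rewrite (perm_big (enum_fset J0 ++ enum_fset K)) /=; last first.
    apply: uniq_perm; rewrite ?fset_uniq // ?cat_uniq ?fset_uniq /= ?andbT.
      by apply/hasPn => i; rewrite !inE => /and3P[].
    by move=> i; rewrite mem_cat !inE.
  rewrite big_cat /= KE.
  have := J0P _ (fsubset_refl J0); rewrite !ltr_norml ler_norml => /andP[? ?] /andP[? ?].
  by apply/andP; split; lra.
have absE : \sum_(i <- J | i \notin J0) `|a i| =
    \sum_(i <- J | (i \notin J0) && (0 <= a i)) a i -
    \sum_(i <- J | (i \notin J0) && ~~ (0 <= a i)) a i.
  rewrite (bigID (fun i => 0 <= a i)) /= -sumrN; congr (_ + _).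
    by apply: eq_bigr => i /andP[_ /ger0_norm].
  by apply: eq_bigr => i /andP[_]; rewrite -ltNge => /ltr0_norm.
rewrite (bigID (mem J0)) /= absE lerD //; last first.
  have := part (fun i => 0 <= a i); have := part (fun i => ~~ (0 <= a i)).
  by rewrite !ler_norml => /andP[? ?] /andP[? ?]; lra.
rewrite [leRHS](bigID (mem J)) /= -[leLHS]addr0 lerD //; last exact: sumr_ge0.
rewrite -[leLHS]big_filter -[leRHS]big_filter le_eqVlt; apply/orP; left; apply/eqP.
apply: perm_big; apply: uniq_perm; rewrite ?filter_uniq ?fset_uniq //.
by move=> i; rewrite !mem_filter andbC.
Qed.

End Series.

(** * Analytic functions as normally convergent series of polynomials *)

Section Expansions.
Context {R : realType} {n : nat}.
Implicit Types (F G : 'rV[R]_n -> R) (a z : 'rV[R]_n) (r C : R) (P : nat -> mpoly n R).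

Definition multinoms_lt N : seq (multinom n) :=
  [seq bmnm m | m <- enum {: bmultinom n N}].

Lemma mem_multinoms_lt N m : (m \in multinoms_lt N) = (mdeg m < N)%N.
Proof.
apply/mapP/idP => [[b _ ->]|mN]; first exact: bmdeg.
by exists (BMultinom mN) => //; rewrite mem_enum.
Qed.

Lemma multinoms_lt_uniq N : uniq (multinoms_lt N).
Proof. by rewrite map_inj_uniq ?enum_uniq //; exact: val_inj. Qed.

Lemma big_multinoms_lt (V : nmodType) N (f : multinom n -> V) :
  \sum_(j < N) \sum_(m <- multinoms_lt j.+1 | mdeg m == j) f m =
  \sum_(m <- multinoms_lt N) f m.
Proof.
elim: N => [|N IH].
  rewrite big_ord0 big_seq big1 // => m; by rewrite mem_multinoms_lt.
rewrite big_ord_recr /= IH [RHS](bigID (fun m => mdeg m == N)) /= addrC; congr (_ + _).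
rewrite -[RHS]big_filter; apply: perm_big; apply: uniq_perm.
- exact: multinoms_lt_uniq.
- by rewrite filter_uniq ?multinoms_lt_uniq.
- by move=> m; rewrite mem_filter !mem_multinoms_lt ltnS ltn_neqAle.
Qed.

Lemma monomZ (t : R) z m : monom m (t *: z) = t ^+ mdeg m * monom m z.
Proof.
rewrite /monom mdegE -prodrXr -big_split /=; apply: eq_bigr => i _.
by rewrite mxE exprMn.
Qed.

Lemma ev_sum z I (s : seq I) (Q : pred I) (p : I -> mpoly n R) :
  ev z (\sum_(i <- s | Q i) p i) = \sum_(i <- s | Q i) ev z (p i).
Proof. exact: raddf_sum. Qed.

Lemma evZ z (c : R) (p : mpoly n R) : ev z (c *: p) = c * ev z p.
Proof. exact: mevalZ. Qed.

Lemma evX z m : ev z (mpolyX R m) = monom m z.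
Proof. exact: mevalX. Qed.

(** A function is given near a by a series of polynomials that converges normally
    for pnorm at radius r; the rate 2 ^- j is a normalisation that turns every
    passage to the limit into an explicit estimate. The P j need not be
    homogeneous, which is why this notion is stable under substitution. *)
Definition normal_expansion r C P a F :=
  (forall j, pnorm r (P j) <= C / 2 ^+ j) /\
  (forall z, `|z| <= r -> forall N,
     `|F (a + z) - \sum_(j < N) ev z (P j)| <= 2 * C / 2 ^+ N).

(** The grouping of a power series by degree: P j is homogeneous of degree j, and
    the remainder of order N is O(|z| ^ N). *)
Definition homogeneous_expansion r C P a F :=
  [/\ forall j s, 0 <= s -> pnorm s (P j) <= C * (s / r) ^+ j,
      forall j t z, ev (t *: z) (P j) = t ^+ j * ev z (P j) &
      forall z, `|z| <= r -> forall N,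
        `|F (a + z) - \sum_(j < N) ev z (P j)| <= C * (`|z| / r) ^+ N].

(** Absolute convergence at the corner (r, ..., r) of a cube bounds all the
    coefficients at once, and the multi-indices of degree less than N are cofinal
    among finite sets of multi-indices. *)
Lemma real_analytic_homogeneous F a : real_analytic_at F a ->
  exists r C P, 0 < r /\ homogeneous_expansion r C P a F.
Proof.
case=> c /nbhs_ballP[e /= e0 ce].
have [r r0 rE] : exists2 r, 0 < r & r = e / 2 by exists (e / 2); rewrite ?divr_gt0.
have cr z : `|z| <= r ->
    summability.partial_sum (fun m => c m * monom m z) A
    @[A --> summability.totally] --> F (a + z).
  move=> zr; have := ce (a + z); rewrite addrAC subrr add0r; apply.
  rewrite -ball_normE /ball_ /= opprD addrA subrr add0r normrN (le_lt_trans zr) //.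
  by rewrite rE; lra.
(* The corner of the cube, where each monomial of degree d takes the value r ^ d. *)
pose w : 'rV[R]_n := const_mx r.
have wr : `|w| <= r.
  by apply: norm_le_coord => [|i]; [exact: ltW|rewrite mxE gtr0_norm].
have monw m : monom m w = r ^+ mdeg m.
  by rewrite mdegE -prodrXr; apply: eq_bigr => i _; rewrite mxE.
have [B BJ] := cvg_totally_bounded (cr w wr).
have {}BJ (s : seq (multinom n)) : uniq s -> \sum_(m <- s) `|c m| * r ^+ mdeg m <= B.
  move=> us; apply: le_trans (BJ [fset m in s]%fset).
  rewrite le_eqVlt; apply/orP; left; apply/eqP.
  rewrite [RHS](perm_big s) /=; last first.
    by apply: uniq_perm => //; [exact: fset_uniq|move=> m; rewrite !inE].
  by apply: eq_bigr => m _; rewrite normrM monw normrX (gtr0_norm r0).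
pose P j := \sum_(m <- multinoms_lt j.+1 | mdeg m == j) c m *: mpolyX R m.
have EP z N : \sum_(j < N) ev z (P j) = \sum_(m <- multinoms_lt N) c m * monom m z.
  rewrite -big_multinoms_lt; apply: eq_bigr => j _; rewrite /P ev_sum.
  by apply: eq_bigr => m _; rewrite evZ evX.
exists r, B, P; split=> //; split.
- move=> j s s0; rewrite /P (le_trans (pnorm_sum _ _ _ s0)) //.
  apply: (@le_trans _ _ (\sum_(m <- multinoms_lt j.+1 | mdeg m == j)
      (`|c m| * r ^+ mdeg m) * (s / r) ^+ j)).
    apply: ler_sum => m /eqP mj; rewrite pnormZ pnormX mj -mulrA -exprMn.
    by rewrite [r * _]mulrC divfK ?gt_eqF.
  rewrite -mulr_suml ler_wpM2r ?exprn_ge0 ?divr_ge0 ?(ltW r0) //.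
  apply: le_trans (BJ _ (multinoms_lt_uniq j.+1)).
  rewrite big_mkcond; apply: ler_sum => m _; case: ifP => // _.
  by rewrite mulr_ge0 ?exprn_ge0 ?(ltW r0).
- move=> j t z; rewrite /P !ev_sum mulr_sumr; apply: eq_bigr => m /eqP mj.
  by rewrite !evZ !evX monomZ mj mulrCA.
- move=> z zr N; rewrite EP; apply/ler_addgt0Pr => d d0.
  have [J0 J0P] := (cvg_totallyP _ _).1 (cr z zr) d d0.
  pose J := (J0 `|` [fset m in multinoms_lt N])%fset.
  have := J0P J (fsubsetUl _ _) => /ltW FJ.
  have JE : \sum_(m <- J) c m * monom m z = \sum_(m <- multinoms_lt N) c m * monom m z +
      \sum_(m <- J | m \notin multinoms_lt N) c m * monom m z.
    rewrite (bigID (mem (multinoms_lt N))) /=; congr (_ + _).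
    rewrite -[LHS]big_filter; apply: perm_big; apply: uniq_perm.
    - by rewrite filter_uniq ?fset_uniq.
    - exact: multinoms_lt_uniq.
    - by move=> m; rewrite mem_filter !inE; case: (m \in multinoms_lt N) => /=; rewrite ?orbT.
  move: FJ; rewrite JE; set SN := \sum_(m <- multinoms_lt N) c m * monom m z.
  set S' := \sum_(m <- J | m \notin multinoms_lt N) c m * monom m z => FJ.
  have -> : F (a + z) - SN = S' + (F (a + z) - (SN + S')) by ring.
  rewrite (le_trans (ler_normD _ _)) // lerD // (le_trans (ler_norm_sum _ _ _)) //.
  rewrite -[leLHS]big_filter; set s := seq.filter _ _.
  have us : uniq s by rewrite filter_uniq ?fset_uniq.
  apply: (@le_trans _ _ (\sum_(m <- s) (`|c m| * r ^+ mdeg m) * (`|z| / r) ^+ N)); last first.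
    by rewrite -mulr_suml ler_wpM2r ?BJ // exprn_ge0 // divr_ge0 // ltW.
  rewrite big_seq [leRHS]big_seq; apply: ler_sum => m.
  rewrite mem_filter mem_multinoms_lt -leqNgt => /andP[Nm _].
  rewrite normrM -mulrA ler_wpM2l // (le_trans (monom_le _ (lexx _))) //.
  have q1 : `|z| / r <= 1 by rewrite ler_pdivrMr // mul1r.
  have q0 : 0 <= `|z| / r by rewrite divr_ge0 // ltW.
  rewrite -{1}(divfK (lt0r_neq0 r0) `|z|) exprMn mulrC ler_wpM2l ?exprn_ge0 ?(ltW r0) //.
  by rewrite ler_wiXn2l.
Qed.

Lemma homogeneous_normal r C P a F : 0 < r -> homogeneous_expansion r C P a F ->
  normal_expansion (r / 2) C P a F.
Proof.
move=> r0 [PC _ FP]; have r20 : 0 < r / 2 by rewrite divr_gt0.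
have C0 : 0 <= C.
  by have := PC 0%N r (ltW r0); rewrite expr0 mulr1; apply: le_trans; rewrite pnorm_ge0 ?ltW.
have E : r / 2 / r = 2^-1 by field; rewrite gt_eqF.
split=> [j|z zr N].
  by rewrite (le_trans (PC _ _ (ltW r20))) // E exprVn.
have zr' : `|z| <= r by rewrite (le_trans zr) //; lra.
rewrite (le_trans (FP _ zr' N)) //.
have h : `|z| / r <= 2^-1 by rewrite -E ler_pM2r ?invr_gt0.
rewrite -mulrA mulrCA ler_wpM2l // -[2 ^- N]exprVn -[leLHS]mul1r ler_pM ?ler1n //.
  by rewrite exprn_ge0 // divr_ge0 // ltW.
by rewrite lerXn2r ?nnegrE // divr_ge0 // ltW.
Qed.

Lemma pnorm_coef r (p : mpoly n R) m : 0 <= r -> `|mcoeff m p| * r ^+ mdeg m <= pnorm r p.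
Proof.
move=> r0; have [mp|mp] := boolP (m \in msupp p); last first.
  by rewrite (memN_msupp_eq0 mp) normr0 mul0r pnorm_ge0.
rewrite /pnorm (bigD1_seq m) ?msupp_uniq //= lerDl sumr_ge0 // => k _.
by rewrite mulr_ge0 ?exprn_ge0.
Qed.

Lemma sum_coef_le_pnorm r (p : mpoly n R) (s : seq (multinom n)) : 0 <= r -> uniq s ->
  \sum_(m <- s) `|mcoeff m p| * r ^+ mdeg m <= pnorm r p.
Proof.
move=> r0 us; pose s' := undup (s ++ msupp p).
rewrite (@pnormE _ _ s') ?undup_uniq //; last first.
  by move=> m mp; rewrite mem_undup mem_cat mp orbT.
rewrite [leRHS](bigID (mem s)) /= -[leLHS]addr0 lerD //; last first.
  by rewrite sumr_ge0 // => k _; rewrite mulr_ge0 ?exprn_ge0.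
rewrite -[leRHS]big_filter le_eqVlt; apply/orP; left; apply/eqP.
apply: perm_big; apply: uniq_perm; rewrite ?filter_uniq ?undup_uniq //.
by move=> m; rewrite mem_filter mem_undup mem_cat /=; case: (m \in s).
Qed.

End Expansions.

Lemma geometric_lt_ex (R : realType) (q C e : R) : 0 <= q < 1 -> 0 < e ->
  exists N, C * q ^+ N < e.
Proof.
move=> /andP[q0 q1] e0.
have : C * q ^+ N @[N --> \oo] --> C * 0.
  by apply: cvgMr; apply: cvg_expr; rewrite ger0_norm.
rewrite mulr0 => /cvgrPdist_lt/(_ e e0)[N _ /(_ N (leqnn N))] /=.
by rewrite sub0r normrN => /(le_lt_trans (ler_norm _)); exists N.
Qed.

Lemma le_geometric0 (R : realType) (x q C : R) : 0 <= q < 1 ->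
  (forall N, x <= C * q ^+ N) -> x <= 0.
Proof.
move=> q01 xC; rewrite leNgt; apply/negP => /(geometric_lt_ex C q01)[N].
by rewrite ltNge xC.
Qed.

Lemma sum_half_le (R : realType) (C : R) K L : 0 <= C ->
  \sum_(i < L) C / 2 ^+ (K + i) <= 2 * C / 2 ^+ K.
Proof.
move=> C0; suff -> : \sum_(i < L) C / 2 ^+ (K + i) = 2 * C / 2 ^+ K * (1 - 2 ^- L).
  rewrite ler_piMr ?lerBlDr ?lerDl ?invr_ge0 ?exprn_ge0 //.
  by rewrite divr_ge0 ?mulr_ge0 ?exprn_ge0.
elim: L => [|L IH]; first by rewrite big_ord0 expr0 invr1 subrr mulr0.
by rewrite big_ord_recr /= IH exprS exprD; field; rewrite !expf_neq0.
Qed.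

Lemma half_lt_ex (R : realType) (C e : R) : 0 < e -> exists N, C / 2 ^+ N < e.
Proof.
move=> e0; have h : 0 <= (2^-1 : R) < 1 by rewrite invr_ge0 ler0n /= invf_lt1 // ltr1n.
by have [N NP] := geometric_lt_ex C h e0; exists N; rewrite -exprVn.
Qed.

Section NormalExpansions.
Context {R : realType} {n : nat}.
Implicit Types (F G : 'rV[R]_n -> R) (a b z : 'rV[R]_n) (r s C : R) (P : nat -> mpoly n R).

Lemma normal_expansion_ge0 r C P a F : 0 <= r -> normal_expansion r C P a F -> 0 <= C.
Proof.
move=> r0 [/(_ 0%N) + _]; rewrite expr0 divr1; apply: le_trans; exact: pnorm_ge0.
Qed.

(** The coefficient of the power series is the sum over j of the coefficients of the
    P j. A finite set of multi-indices containing the supports of P 0, ..., P (K-1)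
    makes an error of at most the tail from K on, since that tail is small for the
    norm pnorm and not only pointwise. *)
Lemma normal_real_analytic r C P a F : 0 < r -> normal_expansion r C P a F ->
  real_analytic_at F a.
Proof.
move=> r0 nF; have C0 := normal_expansion_ge0 (ltW r0) nF; case: nF => PC FP.
have /choice[c cP] : forall m, exists c, forall N,
    `|c - \sum_(j < N) mcoeff m (P j)| * r ^+ mdeg m <= 2 * C / 2 ^+ N.
  move=> m; have rm0 : 0 < r ^+ mdeg m by rewrite exprn_gt0.
  have uC j : `|mcoeff m (P j) * r ^+ mdeg m| <= C / 2 ^+ j.
    by rewrite normrM (gtr0_norm rm0) (le_trans (pnorm_coef _ _ (ltW r0))).
  have [l lP] := geometric_sum_ex uC.
  exists (l / r ^+ mdeg m) => N; rewrite -[X in _ * X <= _](gtr0_norm rm0) -normrM.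
  by rewrite mulrBl mulr_suml divfK ?gt_eqF.
exists c; apply/nbhs_ballP; exists r => // x.
rewrite -ball_normE /ball_ /= -normrN opprB => /ltW xr.
apply/cvg_totallyP => e e0.
have [K KP] := half_lt_ex (4 * C) e0.
exists [fset m in flatten [seq msupp (P j) | j <- iota 0 K]]%fset => J JJ.
rewrite (le_lt_trans _ KP) //.
have EJ : \sum_(j < K) ev (x - a) (P j) =
    \sum_(m <- J) (\sum_(j < K) mcoeff m (P j)) * monom m (x - a).
  transitivity (\sum_(m <- J) \sum_(j < K) mcoeff m (P j) * monom m (x - a)); last first.
    by apply: eq_bigr => m _; rewrite mulr_suml.
  rewrite exchange_big; apply: eq_bigr => j _; rewrite evE.
  have sub : {subset msupp (P j) <= J}.
    move=> m mP; apply: (fsubsetP JJ); rewrite !inE; apply/flatten_mapP.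
    by exists (j : nat) => //; rewrite mem_iota /=.
  rewrite [RHS](bigID (mem (msupp (P j)))) /= [X in _ = _ + X]big1 ?addr0; last first.
    by move=> m /memN_msupp_eq0 ->; rewrite mul0r.
  rewrite -[RHS]big_filter; apply: perm_big; apply: uniq_perm; rewrite ?filter_uniq ?fset_uniq //.
  by move=> m; rewrite mem_filter /=; case: (boolP (m \in msupp _)) => // /sub ->.
have -> : F x - \sum_(m <- J) c m * monom m (x - a) =
    (F x - \sum_(j < K) ev (x - a) (P j)) -
    \sum_(m <- J) (c m - \sum_(j < K) mcoeff m (P j)) * monom m (x - a).
  rewrite EJ -addrA -opprD; congr (_ - _); rewrite -big_split /=.
  by apply: eq_bigr => m _; ring.
have := FP _ xr K; rewrite addrCA subrr addr0 => Fx.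
rewrite (le_trans (ler_normB _ _)) //.
have -> : 4 * C / 2 ^+ K = 2 * C / 2 ^+ K + 2 * C / 2 ^+ K by rewrite -mulrDl; congr (_ / _); ring.
rewrite lerD // (le_trans (ler_norm_sum _ _ _)) //.
apply/ler_addgt0Pr => d d0.
have [L LP] := half_lt_ex ((size J)%:R * (2 * C)) d0.
apply: (@le_trans _ _ (\sum_(m <- J) (\sum_(i < L) `|mcoeff m (P (K + i)%N)| * r ^+ mdeg m
     + 2 * C / 2 ^+ L))).
  apply: ler_sum => m _; rewrite normrM.
  apply: (@le_trans _ _ (`|c m - \sum_(j < K) mcoeff m (P j)| * r ^+ mdeg m)).
    by rewrite ler_wpM2l ?monom_le.
  apply: (@le_trans _ _ ((\sum_(i < L) `|mcoeff m (P (K + i)%N)| +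
    `|c m - \sum_(j < K + L) mcoeff m (P j)|) * r ^+ mdeg m)).
    rewrite ler_wpM2r ?exprn_ge0 ?(ltW r0) //.
    rewrite big_split_ord /= opprD addrA.
    set A := c m - _; set B := \sum_(i < L) mcoeff m _.
    have := ler_normD B (A - B); rewrite [B + _]addrC subrK => /le_trans -> //.
    by rewrite lerD2r ler_norm_sum.
  rewrite mulrDl mulr_suml lerD2l (le_trans (cP _ _)) //.
  rewrite ler_wpM2l ?mulr_ge0 // lef_pV2 ?posrE ?exprn_gt0 //.
  by rewrite ler_weXn2l ?ler1n // leq_addl.
rewrite big_split /= lerD //.
  rewrite exchange_big /= (le_trans _ (sum_half_le K L C0)) //.
  apply: ler_sum => i _; rewrite (le_trans _ (PC _)) //.
  by apply: sum_coef_le_pnorm; rewrite ?ltW ?fset_uniq.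
by rewrite big_const_seq count_predT iter_addr_0 -[_ *+ size _]mulr_natl mulrA ltW.
Qed.

(** With the previous lemma: analyticity at a point is the existence of a normal
    expansion of positive radius. *)
Lemma real_analytic_normal F a : real_analytic_at F a ->
  exists r C P, 0 < r /\ normal_expansion r C P a F.
Proof.
move=> /real_analytic_homogeneous[r [C [P [r0 hF]]]].
by exists (r / 2), C, P; split; [rewrite divr_gt0|exact: homogeneous_normal].
Qed.

Lemma real_analytic_at_eq F G a : (\forall x \near a, F x = G x) ->
  real_analytic_at F a -> real_analytic_at G a.
Proof.
move=> FG [c cF]; exists c; near=> x.
have <- : F x = G x by near: x.
by near: x.
Unshelve. all: by end_near. Qed.

End NormalExpansions.

Lemma normal_expansion_comp (R : realType) n k (F : 'rV[R]_n -> R) (G : 'rV[R]_k -> R)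
    (a : 'rV[R]_n) (b : 'rV[R]_k) (r s C : R) (P : nat -> mpoly n R)
    (q : n.-tuple (mpoly k R)) : 0 <= r -> 0 <= s ->
  (forall i, pnorm s (tnth q i) <= r) ->
  (forall z, `|z| <= s -> G (b + z) = F (a + \row_i ev z (tnth q i))) ->
  normal_expansion r C P a F ->
  normal_expansion s C (fun j => comp_mpoly q (P j)) b G.
Proof.
move=> r0 s0 qr GF [PC FP]; split=> [j|z zs N].
  exact: le_trans (pnorm_comp _ s0 qr) (PC j).
have E p : ev z (comp_mpoly q p) = ev (\row_i ev z (tnth q i)) p.
  rewrite /ev comp_mpoly_meval; congr (meval _ p); apply/funext => i; by rewrite mxE.
rewrite GF //; under eq_bigr do rewrite E.
apply: FP; apply: norm_le_coord => // i.
by rewrite mxE (le_trans _ (qr i)) // ev_le.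
Qed.

(** * Composition with polynomial maps *)

(** Without its constant term a polynomial has norm O(s), so it can be substituted
    in a power series of any positive radius. *)
Lemma pnorm_const_le (R : realType) k (p : mpoly k R) (s : R) : 0 <= s <= 1 ->
  pnorm s (p - mpolyC k (ev 0 p)) <= s * pnorm 1 p.
Proof.
move=> /andP[s0 s1].
have ev0 : ev 0 p = mcoeff mnm0 p.
  have mon0 m : monom m (0 : 'rV[R]_k) = (m == mnm0)%:R.
    have [->|m0] := eqVneq m mnm0.
      by rewrite /monom big1 // => i _; rewrite mnmE expr0.
    have [i mi] : exists i, m i != 0%N.
      apply/existsP; apply: contraNT m0; rewrite negb_exists => /forallP H.
      by apply/eqP/mnmP => i; rewrite mnmE; have := H i; rewrite negbK => /eqP.
    by rewrite /monom (bigD1 i) //= mxE expr0n (negbTE mi) mul0r.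
  rewrite evE; under eq_bigr do rewrite mon0.
  have [mp|mp] := boolP (mnm0 \in msupp p); last first.
    rewrite (memN_msupp_eq0 mp) big1_seq // => m /andP[_ mp'].
    by case: eqVneq mp' => [->|]; rewrite ?(negbTE mp) ?mulr0.
  rewrite (bigD1_seq mnm0) ?msupp_uniq //= eqxx mulr1 big1 ?addr0 // => m /negbTE ->.
  by rewrite mulr0.
pose S := undup (msupp p ++ msupp (p - mpolyC k (ev 0 p))).
rewrite !(@pnormE _ _ S) ?undup_uniq //; first last.
- by move=> m mp; rewrite mem_undup mem_cat mp orbT.
- by move=> m mp; rewrite mem_undup mem_cat mp.
rewrite mulr_sumr; apply: ler_sum => m _; rewrite mcoeffB mcoeffC ev0 expr1n mulr1.
have [->|m0] := eqVneq m mnm0.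
  by rewrite mulr1 subrr normr0 mul0r mulr_ge0.
rewrite mulr0 subr0 mulrC ler_wpM2r //.
case: (mdeg m) (mdeg_eq0 m) => [|d _]; first by rewrite eqxx (negbTE m0).
by rewrite exprS ler_piMr // exprn_ile1.
Qed.

Lemma real_analytic_poly_map (R : realType) n k (p : 'I_n -> mpoly k R) (F : 'rV[R]_n -> R) :
  real_analytic_at F (poly_map p 0) -> real_analytic_at (fun t => F (poly_map p t)) 0.
Proof.
move=> /real_analytic_normal[r [C [P [r0 FP]]]].
pose M := 1 + \sum_i pnorm 1 (p i).
have M1 : 1 <= M by rewrite lerDl sumr_ge0 // => i _; exact: pnorm_ge0.
have M0 : 0 < M by exact: lt_le_trans M1.
pose s := Num.min 1 (r / M).
have s0 : 0 < s by rewrite lt_min ltr01 divr_gt0.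
have s01 : 0 <= s <= 1 by rewrite (ltW s0) /= ge_min lexx.
have sr : s * M <= r by rewrite -ler_pdivlMr // ge_min lexx orbT.
pose q := [tuple p i - mpolyC k (ev 0 (p i)) | i < n].
have qE i : tnth q i = p i - mpolyC k (ev 0 (p i)) by rewrite tnth_mktuple.
apply: (@normal_real_analytic _ _ s C _ _ _ s0).
apply: (@normal_expansion_comp _ _ _ _ _ _ _ _ _ _ _ q (ltW r0) (ltW s0) _ _ FP).
- move=> i; rewrite qE (le_trans (pnorm_const_le _ s01)) //.
  rewrite (le_trans _ sr) // ler_pM2l // /M (bigD1 i) //= addrCA lerDl.
  by rewrite addr_ge0 // sumr_ge0 // => j _; rewrite pnorm_ge0.
- move=> z _; congr F; rewrite add0r; apply/rowP => i; rewrite !mxE qE.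
  by rewrite [ev z _]mevalB [X in _ - X]mevalC addrC subrK.
Qed.

(** Re-expansion: substitute the polynomial (b - a) + X. *)
Lemma normal_expansion_ball (R : realType) n (F : 'rV[R]_n -> R) a b (r C : R) P :
  normal_expansion r C P a F -> `|b - a| < r -> real_analytic_at F b.
Proof.
move=> FP bar; have r0 : 0 < r by exact: le_lt_trans bar.
have s0 : 0 < r - `|b - a| by rewrite subr_gt0.
pose q := [tuple mpolyC n ((b - a) 0 i) + mpolyX R (mnm1 i) | i < n].
apply: (@normal_real_analytic _ _ _ C _ _ _ s0).
apply: (@normal_expansion_comp _ _ _ _ _ _ _ _ _ _ _ q (ltW r0) (ltW s0) _ _ FP).
- move=> i; rewrite tnth_mktuple (le_trans (pnormD _ _ (ltW s0))) //.
  rewrite pnormC pnormX mdeg1 expr1 -lerBrDr opprB addrCA subrr addr0.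
  exact: norm_coord_le.
- move=> z _; congr F; apply/rowP => i; rewrite !mxE tnth_mktuple.
  by rewrite /ev mevalD mevalC mevalXU !mxE; ring.
Qed.

(** * Analytic germs in one variable *)

Section OneVariable.
Context {R : realType}.
Implicit Types (f g : R -> R) (t : R).

(** Real analytic germs in one variable, in the form of Taylor's formula with
    remainders that are geometric in N; the bounds on the coefficients b k follow
    from it. *)
Definition analytic1 f t := exists (r C : R) (b : nat -> R), 0 < r /\
  forall h, `|h| <= r -> forall N,
    `|f (t + h) - \sum_(k < N) b k * h ^+ k| <= C * (`|h| / r) ^+ N.

Lemma analytic1_real_analytic (g : 'rV[R]_1 -> R) f t : real_analytic_at g 0 ->
  (\forall h \near 0, f (t + h) = g (const_mx h)) -> analytic1 f t.
Proof.
move=> /real_analytic_homogeneous[r [C [P [r0 [PC Phom gP]]]]].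
move=> /nbhs_ballP[e /= e0 fg]; pose s := Num.min r (e / 2).
have s0 : 0 < s by rewrite lt_min r0 divr_gt0.
have C0 : 0 <= C.
  by have := PC 0%N r (ltW r0); rewrite expr0 mulr1; apply: le_trans; rewrite pnorm_ge0 ?ltW.
exists s, C, (fun k => ev (const_mx 1) (P k)); split=> // h hs N.
have hr : `|h| <= r by rewrite (le_trans hs) // ge_min lexx.
have he : `|h| < e.
  by rewrite (le_lt_trans hs) // gt_min ltr_pdivrMr // ltr_pMr // ltr1n orbT.
have nh : `|const_mx h : 'rV[R]_1| = `|h|.
  apply/eqP; rewrite eq_le; apply/andP; split.
    by apply: norm_le_coord => // i; rewrite mxE.
  by have := norm_coord_le (const_mx h : 'rV[R]_1) 0; rewrite mxE.
have hE : const_mx h = h *: const_mx 1 :> 'rV[R]_1.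
  by apply/rowP => i; rewrite !mxE mulr1.
rewrite fg; last by rewrite -ball_normE /ball_ /= sub0r normrN.
have := gP (const_mx h); rewrite nh => /(_ hr N); rewrite add0r.
under eq_bigr do rewrite hE Phom mulrC.
move=> /le_trans; apply; rewrite ler_wpM2l // lerXn2r ?nnegrE ?divr_ge0 ?(ltW s0) ?(ltW r0) //.
by rewrite ler_wpM2l // lef_pV2 ?posrE // ge_min lexx.
Qed.

Lemma analytic1B f g t : analytic1 f t -> analytic1 g t ->
  analytic1 (fun s => f s - g s) t.
Proof.
move=> [r [C [b [r0 fb]]]] [r' [C' [b' [r'0 gb]]]].
pose s := Num.min r r'; have s0 : 0 < s by rewrite lt_min r0.
exists s, (`|C| + `|C'|), (fun k => b k - b' k); split=> // h hs N.
have hr : `|h| <= r by rewrite (le_trans hs) // ge_min lexx.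
have hr' : `|h| <= r' by rewrite (le_trans hs) // ge_min lexx orbT.
have -> : \sum_(k < N) (b k - b' k) * h ^+ k =
    \sum_(k < N) b k * h ^+ k - \sum_(k < N) b' k * h ^+ k.
  by rewrite -sumrB; apply: eq_bigr => k _; rewrite mulrBl.
rewrite opprD addrACA -opprD (le_trans (ler_normB _ _)) // mulrDl.
have le1 (u D : R) : 0 < u -> s <= u -> D * (`|h| / u) ^+ N <= `|D| * (`|h| / s) ^+ N.
  move=> u0 su; apply: (@le_trans _ _ (`|D| * (`|h| / u) ^+ N)).
    by rewrite ler_wpM2r ?ler_norm // exprn_ge0 // divr_ge0 // ltW.
  rewrite ler_wpM2l // lerXn2r ?nnegrE ?divr_ge0 ?(ltW s0) ?(ltW u0) //.
  by rewrite ler_wpM2l // lef_pV2.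
apply: lerD; [apply: le_trans (fb h hr N) _|apply: le_trans (gb h hr' N) _].
  by apply: le1 => //; rewrite ge_min lexx.
by apply: le1 => //; rewrite ge_min lexx orbT.
Qed.

(** The points t + h need only accumulate at t, so that this covers both flatness at
    t (the N-th bound is a Taylor remainder) and a zero set accumulating at t
    (with K = 0). The coefficients vanish one after the other, and then the
    remainder is smaller than every power of a number less than 1. *)
Lemma analytic1_flat f t : analytic1 f t ->
  (forall N, exists K, forall e, 0 < e ->
     exists h, 0 < `|h| < e /\ `|f (t + h)| <= K * `|h| ^+ N) ->
  \forall s \near t, f s = 0.
Proof.
move=> [r [C [b [r0 fb]]]] flat.
have b0 k : b k = 0.
  elim/ltn_ind: k => k IH; apply/eqP; rewrite -normr_le0 leNgt; apply/negP => bk.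
  have [K KP] := flat k.+1.
  pose A := `|K| + `|C| / r ^+ k.+1 + 1.
  have A0 : 0 < A by rewrite ltr_wpDl // addr_ge0 // divr_ge0 // exprn_ge0 // ltW.
  have e0 : 0 < Num.min r (`|b k| / A) by rewrite lt_min r0 divr_gt0.
  have [h [/andP[h0]]] := KP _ e0; rewrite lt_min => /andP[hr hA] fh.
  have := fb h (ltW hr) k.+1; rewrite big_ord_recr /= big1 ?add0r; last first.
    by move=> j _; rewrite IH ?mul0r.
  move=> fbk; have : `|b k| * `|h| ^+ k <= (`|K| + `|C| / r ^+ k.+1) * `|h| ^+ k.+1.
    rewrite -normrX -normrM -[X in `|X|](subrK (f (t + h))) mulrDl.
    rewrite (le_trans (ler_normD _ _)) // addrC lerD //.
      by rewrite (le_trans fh) // ler_wpM2r ?exprn_ge0 ?ler_norm.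
    rewrite distrC (le_trans fbk) // expr_div_n mulrA mulrAC ler_wpM2r ?exprn_ge0 //.
    by rewrite ler_wpM2r ?ler_norm // invr_ge0 exprn_ge0 // ltW.
  rewrite [(`|h| ^+ k.+1)%R]exprS mulrA ler_pM2r ?exprn_gt0 // => bkh.
  move: hA; rewrite ltr_pdivlMr // mulrC ltNge => /negP; apply.
  by rewrite (le_trans bkh) // ler_pM2r // lerDl.
apply/nbhs_ballP; exists r => // s; rewrite -ball_normE /ball_ /= distrC => sr.
apply/eqP; rewrite -normr_le0; apply: (@le_geometric0 _ _ (`|s - t| / r) C).
  by rewrite divr_ge0 ?(ltW r0) //= ltr_pdivrMr // mul1r.
move=> N; have := fb (s - t) (ltW sr) N; rewrite [t + _]addrC subrK big1 ?subr0 // => k _.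
by rewrite b0 mul0r.
Qed.

(** Follow the largest interval [0, c] on which f vanishes: zeros accumulate at c
    from the left, so that f vanishes on a neighbourhood of c. *)
Lemma identity_segment f : (forall t, 0 <= t <= 1 -> analytic1 f t) ->
  (exists2 d, 0 < d & forall t, 0 <= t < d -> f t = 0) -> f 1 = 0.
Proof.
move=> fan [d d0 fd].
pose A := [set t | 0 <= t <= 1 /\ forall s, 0 <= s <= t -> f s = 0].
have A0 : A 0.
  split; first by rewrite lexx ler01.
  by move=> s /andP[s0 s1]; apply: fd; rewrite s0 (le_lt_trans s1).
have hA : has_sup A by split; [exists 0|exists 1 => t [/andP[]]].
pose c := sup A.
have c1 : c <= 1 by apply: sup_le_ub; [exists 0|move=> t [/andP[]]].
have fc s : 0 <= s < c -> f s = 0.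
  move=> /andP[s0 /(sup_gt (proj1 hA)) [u [_ fu] su]]; apply: fu.
  by rewrite s0 ltW.
have c0 : 0 < c.
  apply: (@lt_le_trans _ _ (Num.min 1 (d / 2))); first by rewrite lt_min ltr01 divr_gt0.
  apply: (sup_upper_bound hA); split.
    by rewrite le_min ler01 divr_ge0 ?(ltW d0) //= ge_min lexx.
  move=> s /andP[s0 sm]; apply: fd; rewrite s0 (le_lt_trans sm) //.
  by rewrite gt_min ltr_pdivrMr // ltr_pMr // ltr1n orbT.
have /analytic1_flat/(_ _)/nbhs_ballP[|e /= e0 fce] : analytic1 f c.
- by apply: fan; rewrite (ltW c0).
- move=> N; exists 0 => e e0; exists (- (Num.min (c / 2) (e / 2))).
  have m0 : 0 < Num.min (c / 2) (e / 2) by rewrite lt_min !divr_gt0.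
  have mc : Num.min (c / 2) (e / 2) < c.
    by rewrite gt_min; apply/orP; left; lra.
  rewrite normrN gtr0_norm // m0; split.
    by rewrite gt_min; apply/orP; right; lra.
  by rewrite mul0r fc ?normr0 // subr_ge0 ltW //= ltrBlDr ltrDl.
have fz s : 0 <= s < c + e -> f s = 0.
  move=> /andP[s0 sce]; have [sc|cs] := ltP s c; first by rewrite fc // s0.
  by apply: fce; rewrite -ball_normE /ball_ /= distrC ger0_norm ?subr_ge0 // ltrBlDl.
have [c1'|c1'] := ltP c 1; last by apply: fz; rewrite ler01 (le_lt_trans c1') // ltrDl.
exfalso; pose u := Num.min 1 (c + e / 2).
have : u <= c.
  apply: (sup_upper_bound hA); split.
    by rewrite ge_min lexx le_min ler01 addr_ge0 ?divr_ge0 ?(ltW c0) ?(ltW e0).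
  move=> s /andP[s0 su]; apply: fz; rewrite s0 (le_lt_trans su) //.
  by rewrite gt_min; apply/orP; right; lra.
by rewrite leNgt lt_min c1' /= ltrDl divr_gt0.
Qed.

End OneVariable.

Section Curves.
Context {R : realType}.

Definition mpoly1_of (p : {poly R}) : mpoly 1 R :=
  \sum_(k < size p) p`_k *: mpolyX R (mnm_muln (mnm1 0) k).

Lemma ev_mpoly1_of (z : 'rV[R]_1) p : ev z (mpoly1_of p) = p.[z 0 0].
Proof.
rewrite /mpoly1_of ev_sum horner_coef; apply: eq_bigr => k _.
by rewrite evZ evX /monom big_ord1 mulmnE mnm1E eqxx mul1n.
Qed.

Lemma msize_mpoly1_of p : (mmeasure mdeg (mpoly1_of p) <= size p)%N.
Proof.
rewrite (leq_trans (msize_sum _ _ _)) //; apply/bigmax_leqP => k _.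
by rewrite (leq_trans (msizeZ_le _ _)) // msizeX mdegMn mdeg1 mul1n.
Qed.

Context {n : nat}.
Implicit Types (h : 'I_n -> {poly R}) (F : 'rV[R]_n -> R).

Definition shift_curve h (t : R) i : {poly R} := h i \Po ('X + t%:P).

Lemma shift_curveE h t s : poly_curve (shift_curve h t) s = poly_curve h (t + s).
Proof. by apply/rowP => i; rewrite !mxE /shift_curve horner_comp !hornerE addrC. Qed.

Lemma poly_map_curve h t (z : 'rV[R]_1) :
  poly_map (fun i => mpoly1_of (shift_curve h t i)) z = poly_curve h (t + z 0 0).
Proof. by rewrite -shift_curveE; apply/rowP => i; rewrite !mxE -ev_mpoly1_of. Qed.

Lemma analytic1_curve F h t : real_analytic_at F (poly_curve h t) ->
  analytic1 (fun s => F (poly_curve h s)) t.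
Proof.
move=> Fa; pose p i := mpoly1_of (shift_curve h t i).
have : real_analytic_at (fun z => F (poly_map p z)) 0.
  by apply: real_analytic_poly_map; rewrite poly_map_curve mxE addr0.
move/analytic1_real_analytic; apply; apply/nbhs_ballP; exists 1 => //= s _.
by rewrite poly_map_curve mxE.
Qed.

(** The hypothesis on plots concerns germs at 0; translating the parameter of a
    curve keeps its degree, hence the hypothesis holds at every parameter near
    which the curve runs in X. *)
Lemma analytic1_plot (X : set 'rV[R]_n) d f F h t : plot_analytic 1 d X f ->
  (forall z : X, F (val z) = f z) ->
  (forall i, size (h i) <= d.+1)%N -> (\forall s \near t, X (poly_curve h s)) ->
  analytic1 (fun s => F (poly_curve h s)) t.
Proof.
move=> fp Ff hd /nbhs_ballP[e /= e0 hX]; pose p i := mpoly1_of (shift_curve h t i).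
have pX : plots 1 d X p.
  split=> [i|].
    by rewrite (leq_trans (msize_mpoly1_of _)) // size_comp_poly2 ?size_XaddC.
  apply/nbhs_ballP; exists e => // z; rewrite -ball_normE /ball_ /= sub0r normrN => ze.
  rewrite poly_map_curve; apply: hX; rewrite -ball_normE /ball_ /= opprD addrA subrr add0r.
  by rewrite normrN (le_lt_trans (norm_coord_le _ _)).
have [g ga /nbhs_ballP[e' /= e'0 fg]] := fp p pX.
apply: (analytic1_real_analytic ga); apply/nbhs_ballP.
have m0 : 0 < Num.min e e' by rewrite lt_min e0.
exists (Num.min e e') => // s; rewrite -ball_normE /ball_ /= sub0r normrN lt_min => /andP[se se'].
have ts : X (poly_curve h (t + s)).
  by apply: hX; rewrite -ball_normE /ball_ /= opprD addrA subrr add0r normrN.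
rewrite -(fg (const_mx s) _ (SigSub (mem_set ts))) /=.
- by rewrite -Ff.
- rewrite -ball_normE /ball_ /= sub0r normrN; apply: norm_lt_coord => // i; by rewrite mxE.
- by rewrite /p poly_map_curve mxE.
Qed.

End Curves.

(** * Finite differences of analytic germs *)

Section FiniteDifferences.
Context {R : realType}.
Implicit Types (f : R -> R) (t : R).

Definition fdiff_coef k i : R := (-1) ^+ (k + i) * 'C(k, i)%:R.

(** This replaces the k-th Taylor coefficient of f at 0: it involves finitely many values of f, so that it depends
    continuously on parameters as soon as f does. *)
Definition fdiff k t f := \sum_(i < k.+1) fdiff_coef k i * f (t *+ i).

Lemma fdiff_coef_norm k : \sum_(i < k.+1) `|fdiff_coef k i| = 2 ^+ k.
Proof.
rewrite -[2]/(1 + 1) exprDn; apply: eq_bigr => i _.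
by rewrite /fdiff_coef normrM normrX normrN1 expr1n !mul1r normr_nat !expr1n mul1r.
Qed.

Lemma fdiff_coefS k (g : nat -> R) :
  \sum_(i < k.+2) fdiff_coef k.+1 i * g i = \sum_(i < k.+1) fdiff_coef k i * (g i.+1 - g i).
Proof.
rewrite big_ord_recl /=.
transitivity (fdiff_coef k.+1 0 * g 0%N +
  (\sum_(i < k.+1) fdiff_coef k i * g i.+1 - \sum_(i < k.+1) fdiff_coef k i.+1 * g i.+1)).
  congr (_ + _); rewrite -sumrB; apply: eq_bigr => i _.
  rewrite /fdiff_coef binS natrD /bump /= add1n addSn !addnS !exprS; ring.
under [RHS]eq_bigr do rewrite mulrBr.
rewrite sumrB addrCA; congr (_ + _).
have -> : \sum_(i < k.+1) fdiff_coef k i.+1 * g i.+1 = \sum_(i < k) fdiff_coef k i.+1 * g i.+1.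
  by rewrite big_ord_recr /= {2}/fdiff_coef bin_small // mulr0 mul0r addr0.
rewrite [in RHS]big_ord_recl /= opprD; congr (_ - _).
rewrite /fdiff_coef !bin0 addSn exprS; ring.
Qed.

(** Induction on k by Pascal's rule, after expanding (i + 1) ^ j - i ^ j. *)
Lemma fdiff_coef_pow k j : (j <= k)%N ->
  \sum_(i < k.+1) fdiff_coef k i * i%:R ^+ j = if j == k then k`!%:R else 0.
Proof.
elim: k j => [|k IH] j.
  by rewrite leqn0 => /eqP ->; rewrite big_ord1 /fdiff_coef addn0 !expr0 bin0 eqxx !mulr1 fact0.
move=> jk; rewrite (fdiff_coefS _ (fun i => i%:R ^+ j)).
case: j jk => [|j] jk.
  by rewrite big1 // => i _; rewrite !expr0 subrr mulr0.
have E (i : nat) : i.+1%:R ^+ j.+1 - i%:R ^+ j.+1 =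
    \sum_(l < j.+1) 'C(j.+1, l)%:R * i%:R ^+ l :> R.
  rewrite -addn1 natrD [_ + 1]addrC exprDn big_ord_recr /= subnn expr0 binn mul1r mulr1n addrK.
  by apply: eq_bigr => l _; rewrite expr1n mul1r mulr_natl.
under eq_bigr do rewrite E mulr_sumr.
rewrite exchange_big /=.
under eq_bigr do under eq_bigr do rewrite mulrCA.
under eq_bigr => l _.
  rewrite -mulr_sumr IH; last by rewrite -ltnS (leq_trans (ltn_ord l) jk).
  over.
rewrite eqSS big_ord_recr /= big1 ?add0r; last first.
  by move=> l _; rewrite ltn_eqF ?mulr0 // (leq_trans (ltn_ord l)).
case: eqP => [->|_]; last by rewrite mulr0.
by rewrite binSn -natrM factS.
Qed.

Lemma fdiff_sum_le k (u : nat -> R) B : (forall i, (i <= k)%N -> `|u i| <= B) ->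
  `|\sum_(i < k.+1) fdiff_coef k i * u i| <= 2 ^+ k * B.
Proof.
move=> uB; rewrite (le_trans (ler_norm_sum _ _ _)) // -fdiff_coef_norm mulr_suml.
by apply: ler_sum => i _; rewrite normrM ler_wpM2l // uB // -ltnS.
Qed.

Lemma natmul_le (t : R) i k : 0 <= t -> (i <= k)%N -> `|t *+ i| <= t *+ k.
Proof. by move=> t0 ik; rewrite ger0_norm ?mulrn_wge0 // ler_wpMn2l. Qed.

(** The k-th difference kills the Taylor polynomial of degree less than k and the
    remainder of order k is at most C (kt / r) ^ k. A single integer N controls
    all orders k, which is what the category argument needs. *)
Lemma analytic1_fdiff f : analytic1 f 0 ->
  exists2 N : nat, (0 < N)%N & forall k t, 0 < t -> N%:R * (t *+ k) <= 1 ->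
    `|fdiff k t f| <= N%:R ^+ k.+1 * (t *+ k) ^+ k.
Proof.
move=> [r [C [b [r0 fb]]]].
(* N absorbs C, the radius, and the factor 2 ^ k from the weights of the difference. *)
pose N := (Num.bound `|C| + Num.bound (2 / r)).+1.
have NC : `|C| <= N%:R.
  by rewrite (le_trans (ltW (archi_boundP (normr_ge0 C)))) // ler_nat ltnW // ltnS leq_addr.
have Nr : 2 / r <= N%:R.
  have h : 0 <= 2 / r by rewrite divr_ge0 // ltW.
  by rewrite (le_trans (ltW (archi_boundP h))) // ler_nat ltnW // ltnS leq_addl.
have N0 : 0 < N%:R :> R by rewrite ltr0n.
exists N => // k t t0 tN.
have tk0 : 0 <= t *+ k by rewrite mulrn_wge0 // ltW.
have tkr : t *+ k <= r.
  rewrite -(ler_pM2l N0) (le_trans tN) // -ler_pdivrMr // (le_trans _ Nr) //.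
  by rewrite ler_pM2r ?invr_gt0 // ler1n.
have E : fdiff k t f = \sum_(i < k.+1) fdiff_coef k i *
    (f (0 + t *+ i) - \sum_(j < k) b j * (t *+ i) ^+ j).
  rewrite /fdiff; under [RHS]eq_bigr do rewrite mulrBr add0r.
  rewrite sumrB -[LHS]subr0; congr (_ - _).
  under eq_bigr do rewrite mulr_sumr.
  rewrite exchange_big /= big1 // => j _.
  transitivity (b j * t ^+ j * \sum_(i < k.+1) fdiff_coef k i * i%:R ^+ j).
    by rewrite mulr_sumr; apply: eq_bigr => i _; rewrite -[t *+ i]mulr_natl exprMn; ring.
  by rewrite fdiff_coef_pow 1?ltnW // ltn_eqF ?mulr0.
rewrite E (le_trans (@fdiff_sum_le k (fun i => f (0 + t *+ i) - \sum_(j < k) b j * (t *+ i) ^+ j)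
    (`|C| * ((t *+ k) / r) ^+ k) _)) //.
  move=> i ik; have ti := natmul_le (ltW t0) ik.
  rewrite (le_trans (fb _ (le_trans ti tkr) k)) //.
  apply: (@le_trans _ _ (`|C| * (`|t *+ i| / r) ^+ k)).
    by rewrite ler_wpM2r ?ler_norm // exprn_ge0 // divr_ge0 // ltW.
  rewrite ler_wpM2l // lerXn2r ?nnegrE ?divr_ge0 ?(ltW r0) //.
  by rewrite ler_pM2r ?invr_gt0.
rewrite expr_div_n mulrCA -exprVn.
have -> : 2 ^+ k * ((t *+ k) ^+ k * r^-1 ^+ k) = (2 / r) ^+ k * (t *+ k) ^+ k.
  by rewrite exprMn; ring.
rewrite mulrA ler_wpM2r ?exprn_ge0 // exprS ler_pM ?exprn_ge0 ?divr_ge0 ?(ltW r0) //.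
by rewrite lerXn2r ?nnegrE ?divr_ge0 ?(ltW r0) ?(ltW N0).
Qed.

(** Divide by t ^ k and let t tend to 0: the k-th difference of L t ^ k with step t is
    L k! t ^ k. *)
Lemma fdiff_leading_coef k f (L B : R) :
  (forall e, 0 < e -> exists2 d, 0 < d &
     forall t, 0 <= t < d -> `|f t - L * t ^+ k| <= e * t ^+ k) ->
  (exists2 d, 0 < d & forall t, 0 < t < d -> `|fdiff k t f| <= B * t ^+ k) ->
  `|L| * k`!%:R <= B.
Proof.
move=> fL [d d0 fB]; apply/ler_addgt0Pr => e e0.
pose e' := e / (2 ^+ k * k%:R ^+ k + 1).
have den0 : 0 < 2 ^+ k * k%:R ^+ k + 1 :> R.
  by rewrite ltr_wpDl // mulr_ge0 ?exprn_ge0.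
have e'0 : 0 < e' by rewrite divr_gt0.
have [d' d'0 fe] := fL e' e'0.
pose t := Num.min (d / 2) (d' / 2 / k.+1%:R).
have t0 : 0 < t by rewrite lt_min !divr_gt0.
have td : 0 < t < d by rewrite t0 /= gt_min; apply/orP; left; lra.
have tk : t *+ k < d'.
  apply: (@le_lt_trans _ _ (t *+ k.+1)); first by rewrite ler_wpMn2l // ltW.
  rewrite -mulr_natr (@le_lt_trans _ _ (d' / 2)) //; last by lra.
  by rewrite -ler_pdivlMr // ge_min lexx orbT.
have E : L * k`!%:R * t ^+ k = fdiff k t f - \sum_(i < k.+1) fdiff_coef k i *
    (f (t *+ i) - L * (t *+ i) ^+ k).
  rewrite /fdiff -sumrB; transitivity (L * t ^+ k * \sum_(i < k.+1) fdiff_coef k i * i%:R ^+ k).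
    by rewrite fdiff_coef_pow // eqxx; ring.
  by rewrite mulr_sumr; apply: eq_bigr => i _; rewrite -[t *+ i]mulr_natl exprMn; ring.
have tk0 : 0 < t ^+ k by rewrite exprn_gt0.
rewrite -(ler_pM2r tk0) -{1}(gtr0_norm tk0) -[k`!%:R]normr_nat -!normrM E.
rewrite (le_trans (ler_normB _ _)) // mulrDl lerD ?fB //.
rewrite (le_trans (@fdiff_sum_le k (fun i => f (t *+ i) - L * (t *+ i) ^+ k)
   (e' * (t *+ k) ^+ k) _)) //.
  move=> i ik; have ti := natmul_le (ltW t0) ik.
  have ti0 : 0 <= t *+ i by rewrite mulrn_wge0 // ltW.
  rewrite ger0_norm // in ti.
  rewrite (le_trans (fe _ _)) ?ti0 ?(le_lt_trans ti) //.
  by rewrite ler_pM2l // lerXn2r ?nnegrE // (le_trans ti0).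
rewrite -[t *+ k]mulr_natl exprMn mulrCA !mulrA ler_pM2r // -mulrA /e' mulrAC.
by rewrite ler_pdivrMr // ler_pM2l // lerDl.
Qed.

End FiniteDifferences.

(** * Iterated differences in several variables *)

Lemma subr_shift (V : zmodType) (z y w : V) : z - y = w + (z - (y + w)).
Proof. by rewrite opprD (addrA z) [RHS]addrC subrK. Qed.

Section Lines.
Context {R : realType} {n : nat}.
Implicit Types (F G : 'rV[R]_n -> R) (x y z v w : 'rV[R]_n) (h t : R).

Lemma is_derive_line G y v t (d : R) : is_derive (y + t *: v) v G d ->
  is_derive t 1 (fun s => G (y + s *: v)) d.
Proof.
move=> [Gd Gv].
have E : (fun h : R => h^-1 *: (((fun s => G (y + s *: v)) \o shift t) (h *: (1 : R)) - G (y + t *: v))) =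
         (fun h => h^-1 *: ((G \o shift (y + t *: v)) (h *: v) - G (y + t *: v))).
  apply/funext => h /=; congr (_ *: (G _ - _)).
  by rewrite [h *: 1]mulr1 scalerDl addrA addrAC addrC addrA.
apply: DeriveDef; first by rewrite /derivable E.
by rewrite -Gv /derive E.
Qed.

Lemma is_derive_shift G y v w (d : R) : is_derive (y + w) v G d ->
  is_derive y v (fun z => G (z + w)) d.
Proof.
move=> [Gd Gv].
have E : (fun h : R => h^-1 *: (((fun z => G (z + w)) \o shift y) (h *: v) - G (y + w))) =
         (fun h => h^-1 *: ((G \o shift (y + w)) (h *: v) - G (y + w))).
  by apply/funext => h /=; congr (_ *: (G _ - _)); rewrite addrA.
apply: DeriveDef; first by rewrite /derivable E.
by rewrite -Gv /derive E.
Qed.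

Lemma mvt_abs (f df : R -> R) h :
  (forall t, `|t| <= `|h| -> is_derive t 1 f (df t)) ->
  exists2 c, `|c| <= `|h| & f h - f 0 = df c * h.
Proof.
move=> fd.
have fc t : `|t| <= `|h| -> {for t, continuous f}.
  move=> /fd [fdt _]; apply: differentiable_continuous; exact/derivable1_diffP.
have [h0|h0] := leP 0 h.
  have H t : t \in `[0, h]%R -> `|t| <= `|h|.
    by rewrite in_itv /= => /andP[t0 th]; rewrite !ger0_norm.
  have fd' t : t \in `]0, h[%R -> is_derive t 1 f (df t).
    by move=> tI; apply: fd; apply: H; apply: subset_itv_oo_cc.
  have fc' : {within `[0, h], continuous f}.
    by apply: continuous_in_subspaceT => t /set_mem /= tI; apply: fc; exact: H.
  have [c ci ->] := MVT_segment h0 fd' fc'.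
  by exists c; [exact: H|rewrite subr0].
have H t : t \in `[h, 0]%R -> `|t| <= `|h|.
  by rewrite in_itv /= => /andP[th t0]; rewrite !ler0_norm ?lerN2 // ltW.
have fd' t : t \in `]h, 0[%R -> is_derive t 1 f (df t).
  by move=> tI; apply: fd; apply: H; apply: subset_itv_oo_cc.
have fc' : {within `[h, 0], continuous f}.
  by apply: continuous_in_subspaceT => t /set_mem /= tI; apply: fc; exact: H.
have [c ci E] := MVT_segment (ltW h0) fd' fc'.
by exists c; [exact: H|rewrite -opprB E sub0r mulrN opprK].
Qed.

Notation e_ i := (delta_mx 0 i : 'rV[R]_n).

Lemma mvt_line G y v h :
  (forall t, `|t| <= `|h| -> derivable G (y + t *: v) v) ->
  exists2 c, `|c| <= `|h| & G (y + h *: v) - G y = h * 'D_v G (y + c *: v).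
Proof.
move=> Gd; have Gd' t : `|t| <= `|h| ->
    is_derive t 1 (fun t => G (y + t *: v)) ('D_v G (y + t *: v)).
  by move=> th; apply: is_derive_line; apply: derivableP; exact: Gd.
have [c ch E] := mvt_abs Gd'.
by exists c => //; rewrite scale0r addr0 in E; rewrite E mulrC.
Qed.

Fixpoint diff_op h (s : seq 'I_n) G y : R :=
  if s is i :: s' then diff_op h s' G (y + h *: e_ i) - diff_op h s' G y else G y.

Lemma norm_delta (i : 'I_n) : `|e_ i| <= 1.
Proof.
apply: norm_le_coord => // j; rewrite mxE eqxx /=.
by case: (j == i); rewrite ?normr1 ?normr0.
Qed.

Lemma norm_delta_scale (i : 'I_n) h : `|h *: e_ i| <= `|h|.
Proof. by rewrite normrZ ler_piMr // norm_delta. Qed.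

Lemma diff_op_derive h s G y i : 0 <= h ->
  (forall z, `|z - y| <= h *+ size s -> derivable G z (e_ i)) ->
  is_derive y (e_ i) (diff_op h s G) (diff_op h s (fun z => 'D_(e_ i) G z) y).
Proof.
move=> h0; elim: s y => [|j s IH] y Gd /=.
  by apply: derivableP; apply: Gd; rewrite subrr normr0 mulr0n.
have h1 : is_derive (y + h *: e_ j) (e_ i) (diff_op h s G)
   (diff_op h s (fun z => 'D_(e_ i) G z) (y + h *: e_ j)).
  apply: IH => z zy; apply: Gd; rewrite mulrS.
  have -> : z - y = h *: e_ j + (z - (y + h *: e_ j)) by exact: subr_shift.
  rewrite (le_trans (ler_normD _ _)) // lerD // (le_trans (norm_delta_scale _ _)) //.
  by rewrite ger0_norm.
have h2 : is_derive y (e_ i) (diff_op h s G) (diff_op h s (fun z => 'D_(e_ i) G z) y).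
  apply: IH => z zy; apply: Gd; rewrite (le_trans zy) // ler_wpMn2l //.
by apply: is_deriveB => //; exact: is_derive_shift.
Qed.

(** The mean value theorem, applied once for each letter of s1, turns differences
    into partial derivatives at a nearby point; the letters come out in reverse
    order. *)
Lemma diff_op_mvt U F h s1 s2 y : smooth_on U F -> 0 <= h ->
  (forall z, `|z - y| <= h *+ size s1 -> U z) ->
  exists2 z, `|z - y| <= h *+ size s1 &
    diff_op h s1 (iter_partial s2 F) y = h ^+ size s1 * iter_partial (catrev s1 s2) F z.
Proof.
move=> sF h0; elim: s1 s2 y => [|i s1 IH] s2 y Uy /=.
  by exists y; rewrite ?subrr ?normr0 ?mulr0n // expr0 mul1r.
have near_seg t z : `|t| <= h -> `|z - (y + t *: e_ i)| <= h *+ size s1 ->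
    `|z - y| <= h *+ (size s1).+1.
  move=> th zy; rewrite mulrS.
  have -> : z - y = t *: e_ i + (z - (y + t *: e_ i)) by exact: subr_shift.
  by rewrite (le_trans (ler_normD _ _)) // lerD // (le_trans (norm_delta_scale _ _)).
have dd t : `|t| <= h -> is_derive (y + t *: e_ i) (e_ i) (diff_op h s1 (iter_partial s2 F))
    (diff_op h s1 (iter_partial (i :: s2) F) (y + t *: e_ i)).
  move=> th; apply: diff_op_derive => // z zy.
  by have [] := sF s2 z (Uy _ (near_seg _ _ th zy)).
have Dd t : `|t| <= `|h| -> derivable (diff_op h s1 (iter_partial s2 F)) (y + t *: e_ i) (e_ i).
  by rewrite (ger0_norm h0) => /dd[].
have [c ch E] := mvt_line Dd.
rewrite (ger0_norm h0) in ch; have [_ dE] := dd c ch; rewrite dE in E.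
have Uc z : `|z - (y + c *: e_ i)| <= h *+ size s1 -> U z.
  by move=> zy; apply: Uy; exact: near_seg zy.
have [z zy zE] := IH (i :: s2) _ Uc; rewrite zE in E.
exists z; first exact: near_seg zy.
by rewrite exprS -mulrA; exact: E.
Qed.

Lemma diff_op_sum h s y I (r : seq I) (w : I -> R) (G : I -> 'rV[R]_n -> R) :
  diff_op h s (fun v => \sum_(k <- r) w k * G k v) y =
  \sum_(k <- r) w k * diff_op h s (G k) y.
Proof.
elim: s y => [//|i s IH] y /=; rewrite !IH -sumrB.
by apply: eq_bigr => k _; rewrite mulrBr.
Qed.

Lemma diff_op_affine h s y b c G :
  diff_op h s (fun v => G (b + c *: v)) y = diff_op (c * h) s G (b + c *: y).
Proof.
by elim: s y => [//|i s IH] y /=; rewrite !IH scalerDr addrA scalerA.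
Qed.

Lemma diff_op_le h s y G B : 0 <= h -> (forall z, `|z - y| <= h *+ size s -> `|G z| <= B) ->
  `|diff_op h s G y| <= 2 ^+ size s * B.
Proof.
move=> h0; elim: s y => [|i s IH] y GB /=.
  by rewrite expr0 mul1r GB // subrr normr0 mulr0n.
rewrite exprS -mulrA mulr_natl mulr2n (le_trans (ler_normB _ _)) // lerD // IH // => z zy.
  apply: GB; rewrite mulrS.
  have -> : z - y = h *: e_ i + (z - (y + h *: e_ i)) by exact: subr_shift.
  rewrite (le_trans (ler_normD _ _)) // lerD // (le_trans (norm_delta_scale _ _)) //.
  by rewrite ger0_norm.
by apply: GB; rewrite (le_trans zy) // ler_wpMn2l.
Qed.

End Lines.

(** * The chain rule and Taylor's formula in one variable *)

Section DirectionalDerivatives.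
Context {R : realType}.

Lemma is_derive_le (V : normedModType R) (f : V -> R) a v (d : R) :
  (forall e, 0 < e -> exists2 r, 0 < r &
     forall h : R, `|h| < r -> `|f (a + h *: v) - f a - h * d| <= e * `|h|) ->
  is_derive a v f d.
Proof.
move=> fd.
have cv : (fun h => h^-1 *: ((f \o shift a) (h *: v) - f a)) @ 0^' --> d.
  apply/cvgrPdist_le => e e0; have [r r0 fr] := fd e e0.
  apply/nbhs_ballP; exists r => // h; rewrite -ball_normE /ball_ /= sub0r normrN => hr h0.
  have := fr h hr; rewrite [a + _]addrC => fh.
  rewrite -(ler_pM2r (_ : 0 < `|h|)) ?normr_gt0 // -normrM mulrC mulrBr.
  have -> : h * (h^-1 *: (f (h *: v + a) - f a)) = f (h *: v + a) - f a.
    by rewrite /GRing.scale /= mulVKf.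
  by rewrite distrC.
apply: DeriveDef; first by apply/cvg_ex; exists d.
exact: cvg_lim cv.
Qed.

Context {n : nat}.
Implicit Types (F G : 'rV[R]_n -> R) (x y z w : 'rV[R]_n).
Notation e_ i := (delta_mx 0 i : 'rV[R]_n).

Let trunc_row z k : 'rV[R]_n := \row_i (if (i < k)%N then z 0 i else 0).

(** The chain rule from continuous partial derivatives: go from y to y + h z by
    changing one coordinate at a time. *)
Lemma is_derive_line_C1 G y z r : 0 < r ->
  (forall i w, `|w - y| < r -> derivable G w (e_ i)) ->
  (forall i, {for y, continuous (fun w => 'D_(e_ i) G w)}) ->
  is_derive y z G (\sum_i z 0 i * 'D_(e_ i) G y).
Proof.
move=> r0 Gd Gc; apply: is_derive_le => e e0.
pose e' := e / (n%:R * `|z| + 1).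
have den0 : 0 < n%:R * `|z| + 1 by rewrite ltr_wpDl // mulr_ge0.
have e'0 : 0 < e' by rewrite divr_gt0.
have Gci i : \forall w \near y, `|'D_(e_ i) G y - 'D_(e_ i) G w| <= e'.
  by have /cvgrPdist_le := Gc i; exact.
have : \forall w \near y, forall i, `|'D_(e_ i) G y - 'D_(e_ i) G w| <= e'.
  exact: (@filter_forall _ _ (fun i w => `|'D_(e_ i) G y - 'D_(e_ i) G w| <= e') _ _ Gci).
move=> /nbhs_ballP[d /= d0 dG].
pose m := Num.min r d; have m0 : 0 < m by rewrite lt_min r0.
have den2 : 0 < 2 * `|z| + 1 by rewrite ltr_wpDl // mulr_ge0.
exists (m / (2 * `|z| + 1)); first by rewrite divr_gt0.
move=> h; rewrite ltr_pdivlMr // => hm.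
pose f k := G (y + h *: trunc_row z k).
have -> : G (y + h *: z) - G y - h * (\sum_i z 0 i * 'D_(e_ i) G y) =
    \sum_(k < n) (f k.+1 - f k - h * (z 0 k * 'D_(e_ k) G y)).
  rewrite sumrB mulr_sumr; congr (_ - _).
  rewrite -(big_mkord xpredT (fun k => f k.+1 - f k)) telescope_sumr // /f.
  congr (G (y + h *: _) - _).
    by apply/rowP => i; rewrite !mxE ltn_ord.
  rewrite (_ : trunc_row z 0 = 0) ?scaler0 ?addr0 //; by apply/rowP => i; rewrite !mxE.
rewrite (le_trans (ler_norm_sum _ _ _)) //.
apply: (@le_trans _ _ (\sum_(k < n) `|h| * `|z| * e')); last first.
  rewrite sumr_const card_ord -mulr_natr.
  have -> : `|h| * `|z| * e' * n%:R = `|h| * (n%:R * `|z| * e') by ring.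
  rewrite [leRHS]mulrC ler_wpM2l // /e' mulrA ler_pdivrMr // mulrC ler_wpM2l ?(ltW e0) //.
  by rewrite lerDl.
apply: ler_sum => k _.
have trS : trunc_row z k.+1 = trunc_row z k + z 0 k *: e_ k.
  apply/rowP => i; rewrite !mxE eqxx /= ltnS leq_eqVlt -val_eqE /=.
  have [ik|ik] := eqVneq (i : nat) k.
    by rewrite ik ltnn mulr1 add0r (_ : i = k) //; apply: val_inj.
  by rewrite mulr0 addr0.
have trle : `|trunc_row z k| <= `|z|.
  apply: norm_le_coord => // i; rewrite mxE; case: ifP => _; rewrite ?normr0 //.
  exact: norm_coord_le.
have close c : `|c| <= `|h * z 0 k| -> `|y + h *: trunc_row z k + c *: e_ k - y| < m.
  move=> ch; rewrite addrAC [y + _]addrC addrK (le_lt_trans _ hm) //.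
  rewrite (le_trans (ler_normD _ _)) // mulrDr mulr1 mulr_natl mulr2n mulrDr.
  rewrite -addrA lerD //; first by rewrite normrZ ler_wpM2l.
  rewrite (le_trans (norm_delta_scale _ _)) // (le_trans ch) // normrM.
  by rewrite -[leLHS]addr0 lerD // ler_wpM2l // norm_coord_le.
have Gdl t : `|t| <= `|h * z 0 k| -> derivable G (y + h *: trunc_row z k + t *: e_ k) (e_ k).
  by move=> /close; rewrite lt_min => /andP[tr _]; exact: Gd.
have [c ch E] := mvt_line Gdl.
rewrite {1}/f trS scalerDr addrA scalerA E mulrA -mulrBr normrM.
rewrite ler_pM // ?normrM ?ler_wpM2l ?norm_coord_le //.
rewrite distrC; apply: dG; rewrite -ball_normE /ball_ /= distrC.
by have := close c ch; rewrite lt_min => /andP[].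
Qed.

End DirectionalDerivatives.

Section Taylor.
Context {R : realType}.

Lemma is_derive_powers N (a : nat -> R) (t : R) :
  is_derive t 1 (fun s => \sum_(j < N.+1) a j * s ^+ j / j`!%:R)
    (\sum_(j < N) a j.+1 * t ^+ j / j`!%:R).
Proof.
elim: N => [|N IH].
  rewrite big_ord0; under eq_fun do rewrite big_ord1 expr0 mulr1.
  exact: is_derive_cst.
under eq_fun do rewrite big_ord_recr /=; rewrite big_ord_recr /=.
apply: is_deriveD.
have -> : (fun s => a N.+1 * s ^+ N.+1 / N.+1`!%:R) =
    (a N.+1 / N.+1`!%:R) \*: ((id : R -> R) ^+ N.+1).
  by apply/funext => s; rewrite exprfctE mulrAC.
have H := is_deriveZ (a N.+1 / N.+1`!%:R) (is_deriveX N.+1 (is_derive_id t (1 : R))).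
apply: (is_derive_eq H).
transitivity (a N.+1 / (N.+1`!%:R) * (N.+1%:R * t ^+ N * 1)); first by [].
rewrite factS natrM; field.
by rewrite nat1r !pnatr_eq0 -lt0n fact_gt0.
Qed.

(** The constant M instead of M / N! is enough here, and it makes the induction a
    single use of the mean value theorem. *)
Lemma taylor_le N (f : nat -> R -> R) (M : R) :
  (forall j (t : R), (j < N)%N -> 0 <= t <= 1 -> is_derive t 1 (f j) (f j.+1 t)) ->
  (forall t : R, 0 <= t <= 1 -> `|f N t| <= M) ->
  forall t : R, 0 <= t <= 1 ->
    `|f 0%N t - \sum_(j < N) f j 0 * t ^+ j / j`!%:R| <= M * t ^+ N.
Proof.
elim: N f => [|N IH] f fd fM t t01.
  by rewrite big_ord0 subr0 expr0 mulr1 fM.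
have /andP[t0 t1] := t01.
have h j (s : R) : (j < N)%N -> 0 <= s <= 1 -> is_derive s 1 (f j.+1) (f j.+2 s).
  by move=> jN; apply: fd.
have {}IH := IH (fun j => f j.+1) h fM.
pose g (s : R) := f 0%N s - \sum_(j < N.+1) f j 0 * s ^+ j / j`!%:R.
have gd (s : R) : 0 <= s <= 1 -> is_derive s 1 g (f 1%N s - \sum_(j < N) f j.+1 0 * s ^+ j / j`!%:R).
  by move=> s01; apply: is_deriveB; [exact: fd|exact: (is_derive_powers N (f^~ 0))].
have g0 : g 0 = 0.
  rewrite /g big_ord_recl big1 ?addr0 /=; last first.
    by move=> i _; rewrite expr0n /= mulr0 mul0r.
  by rewrite expr0 fact0 mulr1 divr1 subrr.
have H (s : R) : s \in `[0, t]%R -> 0 <= s <= 1.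
  by rewrite in_itv /= => /andP[-> st]; rewrite (le_trans st).
have gd' (s : R) : s \in `]0, t[%R -> is_derive s 1 g (f 1%N s - \sum_(j < N) f j.+1 0 * s ^+ j / j`!%:R).
  by move=> sI; apply: gd; apply: H; apply: subset_itv_oo_cc.
have gc : {within `[0, t], continuous g}.
  apply: continuous_in_subspaceT => s /set_mem /= /H /gd[gs _].
  by apply: differentiable_continuous; exact/derivable1_diffP.
have [c cI E] := MVT_segment t0 gd' gc.
rewrite -/(g t) -[g t]subr0 -{1}g0 E subr0 normrM (ger0_norm t0) exprSr mulrA ler_wpM2r //.
have c01 := H c cI; rewrite (le_trans (IH c c01)) //.
have M0 : 0 <= M by exact: le_trans (normr_ge0 _) (fM c c01).
move: cI; rewrite in_itv /= => /andP[c0 ct].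
by rewrite ler_wpM2l // lerXn2r ?nnegrE.
Qed.

End Taylor.

(** * Taylor polynomials in several variables *)

(** Both sides are compared with the falling factorial (2j)! / j!, by means of the
    central binomial coefficient. *)
Lemma expnn_le_fact j : (j ^ j <= 4 ^ j * j`!)%N.
Proof.
have h : (j ^ j <= (2 * j) ^_ j)%N.
  rewrite ffact_prod -[X in (X <= _)%N](_ : \prod_(i < j) j = _)%N; last first.
    by rewrite prod_nat_const card_ord.
  by apply: leq_prod => i _; have := ltn_ord i; lia.
apply: (leq_trans h); rewrite -bin_ffact leq_mul2r; apply/orP; right.
have -> : (4 ^ j = (1 + 1) ^ (2 * j))%N by rewrite expnM.
have jj : (j < (2 * j).+1)%N by lia.
rewrite Pascal (bigD1 (Ordinal jj)) //= !exp1n !muln1.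
exact: leq_addr.
Qed.

Section WordSums.
Context {n : nat}.

(** Words of length j are used in place of multi-indices of degree j: this avoids any
    appeal to the symmetry of higher partial derivatives. *)
Fixpoint word_sum (V : nmodType) j (f : seq 'I_n -> V) : V :=
  if j is j'.+1 then \sum_(i < n) word_sum j' (fun s => f (i :: s)) else f [::].

Lemma eq_word_sum (V : nmodType) j (f g : seq 'I_n -> V) :
  (forall s, size s = j -> f s = g s) -> word_sum j f = word_sum j g.
Proof.
elim: j f g => [|j IH] f g fg /=; first exact: fg.
by apply: eq_bigr => i _; apply: IH => s sj; apply: fg; rewrite /= sj.
Qed.

Lemma word_sum_sum (V : nmodType) j (f : 'I_n -> seq 'I_n -> V) :
  word_sum j (fun s => \sum_(i < n) f i s) = \sum_(i < n) word_sum j (f i).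
Proof.
elim: j f => [//|j IH] f /=; under eq_bigr do rewrite IH.
exact: exchange_big.
Qed.

Context {R : realType}.

Lemma ler_word_sum j (f g : seq 'I_n -> R) :
  (forall s, size s = j -> f s <= g s) -> word_sum j f <= word_sum j g.
Proof.
elim: j f g => [|j IH] f g fg /=; first exact: fg.
by apply: ler_sum => i _; apply: IH => s sj; apply: fg; rewrite /= sj.
Qed.

Lemma norm_word_sum j (f : seq 'I_n -> R) :
  `|word_sum j f| <= word_sum j (fun s => `|f s|).
Proof.
elim: j f => [//|j IH] f /=; rewrite (le_trans (ler_norm_sum _ _ _)) //.
by apply: ler_sum => i _.
Qed.

Lemma word_sum_mull j (c : R) (f : seq 'I_n -> R) :
  word_sum j (fun s => c * f s) = c * word_sum j f.
Proof.
elim: j f => [//|j IH] f /=; rewrite mulr_sumr.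
by apply: eq_bigr => i _; rewrite IH.
Qed.

Lemma word_sum_cst j (c : R) : word_sum j (fun=> c) = n%:R ^+ j * c.
Proof.
elim: j => [|j IH] /=; first by rewrite expr0 mul1r.
by rewrite sumr_const card_ord IH exprS -mulrA mulr_natl.
Qed.

Lemma ev_word_sum (z : 'rV[R]_n) j (f : seq 'I_n -> mpoly n R) :
  ev z (word_sum j f) = word_sum j (fun s => ev z (f s)).
Proof.
elim: j f => [//|j IH] f /=; rewrite ev_sum.
by apply: eq_bigr => i _; rewrite IH.
Qed.

Lemma pnorm_word_sum (r : R) j (f : seq 'I_n -> mpoly n R) : 0 <= r ->
  pnorm r (word_sum j f) <= word_sum j (fun s => pnorm r (f s)).
Proof.
move=> r0; elim: j f => [//|j IH] f /=; rewrite (le_trans (pnorm_sum _ _ _ r0)) //.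
by apply: ler_sum => i _; exact: IH.
Qed.

Lemma is_derive_word_sum j (f : seq 'I_n -> R -> R) (df : seq 'I_n -> R) (t : R) :
  (forall s, size s = j -> is_derive t 1 (f s) (df s)) ->
  is_derive t 1 (fun u => word_sum j (fun s => f s u)) (word_sum j df).
Proof.
elim: j f df => [|j IH] f df fd /=; first exact: fd.
have -> : (fun u => \sum_(i < n) word_sum j (fun s => f (i :: s) u)) =
    \sum_(i < n) (fun u => word_sum j (fun s => f (i :: s) u)).
  by apply/funext => u; rewrite fct_sumE.
apply: is_derive_sum => i; apply: IH => s sj; apply: fd; by rewrite /= sj.
Qed.

Lemma continuous_word_sum (T : topologicalType) j (f : seq 'I_n -> T -> R) (x : T) :
  (forall s, size s = j -> {for x, continuous (f s)}) ->
  {for x, continuous (fun u => word_sum j (fun s => f s u))}.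
Proof.
elim: j f => [|j IH] f fc /=; first exact: fc.
apply: cvg_big => [|i _]; first exact: add_continuous.
by apply: IH => s sj; apply: fc; rewrite /= sj.
Qed.

End WordSums.

Section TaylorPolynomials.
Context {R : realType} {n : nat}.
Implicit Types (F : 'rV[R]_n -> R) (x y z : 'rV[R]_n) (s : seq 'I_n).

Definition word_monom z s : R := \prod_(i <- s) z 0 i.

(** The homogeneous part of degree j of the Taylor series of F at x, written as a
    sum over words: (1 / j!) sum over |s| = j of (d_s F)(x) X_s. *)
Definition taylor_poly F x j : mpoly n R :=
  j`!%:R^-1 *: word_sum j (fun s => iter_partial s F x *: \prod_(i <- s) mpolyX R (mnm1 i)).

Lemma norm_word_monom z s : `|word_monom z s| <= `|z| ^+ size s.
Proof.
rewrite /word_monom normr_prod; elim: s => [|i s IH]; first by rewrite big_nil.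
by rewrite big_cons exprS ler_pM ?prodr_ge0 ?norm_coord_le.
Qed.

Lemma ev_taylor_poly F x j z : ev z (taylor_poly F x j) =
  j`!%:R^-1 * word_sum j (fun s => word_monom z s * iter_partial s F x).
Proof.
rewrite /taylor_poly evZ; congr (_ * _).
rewrite ev_word_sum; apply: eq_word_sum => s _; rewrite evZ mulrC; congr (_ * _).
rewrite /ev rmorph_prod; apply: eq_bigr => i _; exact: mevalXU.
Qed.

Lemma pnorm_taylor_poly F x (C L r : R) j : 0 <= r -> 0 <= L -> 0 <= C ->
  (forall s, `|iter_partial s F x| <= C * (L * (size s)%:R) ^+ size s) ->
  pnorm r (taylor_poly F x j) <= C * (4 * n%:R * L * r) ^+ j.
Proof.
move=> r0 L0 C0 FC; rewrite /taylor_poly pnormZ.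
have f0 : 0 < j`!%:R :> R by rewrite ltr0n fact_gt0.
rewrite normfV normr_nat ler_pdivrMl //.
rewrite (le_trans (pnorm_word_sum _ _ r0)) //.
apply: (@le_trans _ _ (word_sum j (fun=> (C * (L * j%:R) ^+ j) * r ^+ j) : R)).
  apply: ler_word_sum => s sj; rewrite pnormZ ler_pM ?pnorm_ge0 //; first by rewrite -sj.
  rewrite (le_trans (pnorm_prod _ _ _ r0)) // -sj; elim: {sj} s => [|i s IH].
    by rewrite big_nil.
  by rewrite big_cons exprS ler_pM ?IH ?prodr_ge0 ?pnorm_ge0 // => *; rewrite ?pnorm_ge0 // pnormX mdeg1 expr1.
rewrite word_sum_cst.
have -> : n%:R ^+ j * (C * (L * j%:R) ^+ j * r ^+ j) = C * (n%:R * L * r) ^+ j * (j ^ j)%:R.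
  by rewrite !exprMn natrX; ring.
have -> : j`!%:R * (C * (4 * n%:R * L * r) ^+ j) = C * (n%:R * L * r) ^+ j * (4 ^ j * j`!)%:R.
  by rewrite natrM natrX !exprMn; ring.
by rewrite ler_wpM2l ?ler_nat ?expnn_le_fact // mulr_ge0 // exprn_ge0 // !mulr_ge0.
Qed.

(** Taylor's formula for t |-> F (x + t z), whose j-th derivative is the sum over
    words of length j by the chain rule. *)
Lemma taylor_remainder U F x N : open U -> smooth_on U F -> U x ->
  exists K r, 0 < r /\ forall z, `|z| < r ->
    `|F (x + z) - \sum_(j < N) ev z (taylor_poly F x j)| <= K * `|z| ^+ N.
Proof.
move=> oU sF Ux.
(* D dominates all derivatives of order N at once and is continuous at x. *)
pose D y : R := word_sum N (fun s => `|iter_partial s F y|).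
have Dc : {for x, continuous D}.
  apply: continuous_word_sum => s _; have [sc _] := sF s x Ux.
  exact: (continuous_comp sc (@norm_continuous _ _ _)).
have /nbhs_ballP[r1 /= r10 DU] : \forall y \near x, D y < D x + 1 /\ U y.
  near=> y; split; last by near: y; exact: open_nbhs_nbhs.
  have : `|D x - D y| < 1 by near: y; move/cvgrPdist_lt: Dc; apply.
  by rewrite ltr_norml => /andP[+ _]; lra.
exists (D x + 1), r1; split=> // z zr.
have seg (t : R) : 0 <= t <= 1 -> `|x + t *: z - x| < r1.
  move=> /andP[t0 t1]; rewrite [x + _]addrC addrK normrZ ger0_norm // (le_lt_trans _ zr) //.
  by rewrite ler_piMl.
have segU (t : R) : 0 <= t <= 1 -> D (x + t *: z) < D x + 1 /\ U (x + t *: z).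
  by move=> /seg tr; apply: DU; rewrite -ball_normE /ball_ /= distrC.
pose f j t := word_sum j (fun s => word_monom z s * iter_partial s F (x + t *: z)).
have fd j (t : R) : (j < N)%N -> 0 <= t <= 1 -> is_derive t 1 (f j) (f j.+1 t).
  move=> _ t01; have [_ Ut] := segU t t01.
  have [r2 r20 Ur2] : exists2 r2, 0 < r2 & forall w, `|w - (x + t *: z)| < r2 -> U w.
    have /nbhs_ballP[r2 /= r20 H] := open_nbhs_nbhs (conj oU Ut).
    by exists r2 => // w wr; apply: H; rewrite -ball_normE /ball_ /= distrC.
  have -> : f j.+1 t = word_sum j (fun s => word_monom z s *:
      \sum_i z 0 i * 'D_(delta_mx 0 i) (iter_partial s F) (x + t *: z)).
    rewrite /f /= -word_sum_sum; apply: eq_word_sum => s _.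
    rewrite /GRing.scale /= mulr_sumr; apply: eq_bigr => i _.
    by rewrite /word_monom big_cons mulrCA mulrA.
  apply: is_derive_word_sum => s _.
  apply: (@is_deriveZ _ _ _ (fun u : R => iter_partial s F (x + u *: z))).
  apply: is_derive_line; refine (@is_derive_line_C1 _ _ _ _ _ _ r20 _ _).
    by move=> i w /Ur2 /(sF s)[_]; exact.
  by move=> i; have [] := sF (i :: s) _ Ut.
have fN (t : R) : 0 <= t <= 1 -> `|f N t| <= (D x + 1) * `|z| ^+ N.
  move=> t01; have [DD _] := segU t t01.
  rewrite (le_trans (norm_word_sum _ _)) //.
  apply: (@le_trans _ _ (`|z| ^+ N * D (x + t *: z))).
    rewrite /D -word_sum_mull; apply: ler_word_sum => s sN.
    by rewrite normrM ler_wpM2r // -sN norm_word_monom.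
  by rewrite mulrC ler_wpM2r ?exprn_ge0 // ltW.
have := taylor_le fd fN; move=> /(_ 1); rewrite ler01 lexx expr1n mulr1 => /(_ isT).
rewrite {1}/f /= /word_monom big_nil mul1r scale1r.
congr (`| _ - _| <= _); apply: eq_bigr => j _; rewrite ev_taylor_poly expr1n mulr1 mulrC.
by congr (_ * _); apply: eq_word_sum => s _; rewrite scale0r addr0.
Unshelve. all: by end_near. Qed.

(** The bound j ^ j <= 4 ^ j j! turns Cauchy estimates at the single point x into
    geometric bounds on the Taylor polynomials. The sum T need not agree with F
    near x; the two have the same asymptotic expansion at x. *)
Lemma taylor_series_ex F x (C L : R) : 0 <= C -> 0 <= L ->
  (forall s, `|iter_partial s F x| <= C * (L * (size s)%:R) ^+ size s) ->
  exists r T, [/\ 0 < r, normal_expansion r C (taylor_poly F x) x T &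
    forall N, exists K, forall z, `|z| <= r ->
      `|T (x + z) - \sum_(j < N) ev z (taylor_poly F x j)| <= K * `|z| ^+ N].
Proof.
move=> C0 L0 FC; pose A := 4 * n%:R * L.
have A0 : 0 <= A by rewrite !mulr_ge0.
pose r := (2 * (A + 1))^-1.
have r0 : 0 < r by rewrite invr_gt0 mulr_gt0 // ltr_wpDl.
have Ar : A * r <= 2^-1.
  rewrite /r invfM mulrCA ler_piMr ?invr_ge0 // ler_pdivrMr ?mul1r ?lerDl //.
  by rewrite ltr_wpDl.
have PC (u : R) j : 0 <= u -> pnorm u (taylor_poly F x j) <= C * (A * u) ^+ j.
  by move=> u0; rewrite pnorm_taylor_poly.
have PC' j : pnorm r (taylor_poly F x j) <= C / 2 ^+ j.
  rewrite (le_trans (PC _ _ (ltW r0))) // ler_wpM2l // -exprVn.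
  by rewrite lerXn2r ?nnegrE ?invr_ge0 // mulr_ge0 // ltW.
have /choice[S SP] : forall z, exists l, `|z| <= r -> forall N,
    `|l - \sum_(j < N) ev z (taylor_poly F x j)| <= 2 * C / 2 ^+ N.
  move=> z; have [zr|] := boolP (`|z| <= r); last by exists 0.
  have uC j : `|ev z (taylor_poly F x j)| <= C / 2 ^+ j.
    exact: le_trans (ev_le _ zr) (PC' j).
  by have [l lP] := geometric_sum_ex uC; exists l.
exists r, (fun y => S (y - x)); split=> //.
  by split=> // z zr N; rewrite [x + z]addrC addrK; exact: SP.
move=> N; exists (2 * C * A ^+ N) => z zr; rewrite [x + z]addrC addrK.
apply/ler_addgt0Pr => e e0; have [M MP] := half_lt_ex (2 * C) e0.
have Az : A * `|z| <= 2^-1 by rewrite (le_trans _ Ar) // ler_wpM2l.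
have := SP z zr (N + M)%N; rewrite big_split_ord /=.
set S1 := \sum_(i < N) _; set S2 := \sum_(i < M) _ => SP'.
have -> : S z - S1 = S2 + (S z - (S1 + S2)) by ring.
rewrite (le_trans (ler_normD _ _)) // lerD //; last first.
  rewrite (le_trans SP') // ltW // (le_lt_trans _ MP) // ler_wpM2l ?mulr_ge0 //.
  by rewrite lef_pV2 ?posrE ?exprn_gt0 // ler_weXn2l ?ler1n // leq_addl.
rewrite (le_trans (ler_norm_sum _ _ _)) //.
apply: (@le_trans _ _ (\sum_(i < M) (C * (A * `|z|) ^+ N) / 2 ^+ (0 + i))).
  apply: ler_sum => i _; rewrite (le_trans (ev_le _ (lexx _))) // (le_trans (PC _ _ _)) //.
  rewrite exprD mulrA ler_wpM2l ?mulr_ge0 ?exprn_ge0 ?mulr_ge0 // -exprVn.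
  by rewrite lerXn2r ?nnegrE ?invr_ge0 // mulr_ge0.
rewrite (le_trans (sum_half_le _ _ _)) ?mulr_ge0 ?exprn_ge0 ?mulr_ge0 //.
by rewrite expr0 divr1 exprMn !mulrA.
Qed.

End TaylorPolynomials.

(** * Cauchy estimates from Baire's theorem *)

HB.instance Definition _ (R : realType) (n : nat) :=
  Uniform_isComplete.Build 'rV[R]_n (@cauchy_cvg 'rV[R]_n).

Section Category.
Context {R : realType} {n : nat}.
Implicit Types (F : 'rV[R]_n -> R) (x y z v : 'rV[R]_n) (r t : R).

Lemma closed_bounded_family (I : Type) r (g : I -> 'rV[R]_n -> R) (B : I -> R) :
  (forall i v, `|v| <= r -> {for v, continuous (g i)}) ->
  closed [set v | `|v| <= r /\ forall i, `|g i v| <= B i].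
Proof.
move=> gc v clv.
have vr : `|v| <= r.
  rewrite leNgt; apply/negP => rv.
  have : nbhs v (ball v (`|v| - r)) by apply: nbhsx_ballx; rewrite subr_gt0.
  move=> /clv[w [[wr _]]]; rewrite -ball_normE /ball_ /= => vw.
  have := ler_normD (v - w) w; rewrite subrK; lra.
split=> // i; rewrite leNgt; apply/negP => Bg.
have e0 : 0 < `|g i v| - B i by rewrite subr_gt0.
have /cvgrPdist_lt/(_ _ e0)/clv[w [[_ /(_ i) wB] gw]] := gc i v vr.
by have := ler_normD (g i v - g i w) (g i w); rewrite subrK; move: gw => /=; lra.
Qed.

Lemma baire_ball r (A : nat -> set 'rV[R]_n) : 0 < r -> (forall N, closed (A N)) ->
  (forall v, `|v| <= r -> exists N, A N v) ->
  exists N v e, 0 < e /\ forall w, `|w - v| <= e -> A N w.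
Proof.
move=> r0 Acl cov; apply: contrapT => H.
have : dense (\bigcap_i ~` A i).
  apply: (@Baire R 'rV[R]_n) => i; split; first exact: closed_openC.
  move=> W [v Wv] oW; apply: contrapT => WA; apply: H.
  have /nbhs_ballP[e /= e0 We] := open_nbhs_nbhs (conj oW Wv).
  exists i, v, (e / 2); split=> [|w wv]; first by rewrite divr_gt0.
  apply: contrapT => Aw; apply: WA; exists w; split=> //; apply: We.
  by rewrite -ball_normE /ball_ /= distrC (le_lt_trans wv) //; lra.
move=> /(_ (ball 0 r)) []; first by exists 0; exact: ballxx.
  exact: ball_open.
move=> v [+ nA]; rewrite -ball_normE /ball_ /= sub0r normrN => /ltW/cov[N AN].
exact: (nA N).
Qed.

Lemma fdiff_continuous (T : topologicalType) k t (G : T -> R -> R) (v : T) :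
  (forall i, (i <= k)%N -> {for v, continuous (fun w => G w (t *+ i))}) ->
  {for v, continuous (fun w => fdiff k t (G w))}.
Proof.
move=> Gc; apply: cvg_big => [|i _]; first exact: add_continuous.
by apply: cvgMr; apply: Gc; rewrite -ltnS.
Qed.

Section CauchyEstimates.
Variables (U : set 'rV[R]_n) (F : 'rV[R]_n -> R) (x : 'rV[R]_n) (b : R -> 'rV[R]_n).
Variables (e : nat) (M : R).
Hypotheses (oU : open U) (sF : smooth_on U F) (Ux : U x) (e0 : (0 < e)%N) (M0 : 0 < M).
Hypothesis bx : forall d, 0 < d -> exists2 r, 0 < r &
  forall t, 0 <= t < r -> `|b t - x| < d.
Hypothesis bU : forall v t, `|v| <= M -> 0 <= t <= 1 -> U (b t + t ^+ e *: v).
Hypothesis Fan : forall v, `|v| <= M -> analytic1 (fun t => F (b t + t ^+ e *: v)) 0.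

(** For each direction w the function u |-> F (b u + u ^ e w) is analytic at 0, so
    its differences obey the bounds of [analytic1_fdiff] for some N. For fixed N the
    set of such w is closed, because a difference of given order and step is a
    continuous function of w; hence one N serves a whole ball of directions. *)
Lemma uniform_fdiff : exists N v r, 0 < r /\ forall w, `|w - v| <= r ->
  forall k t, 0 < t -> N.+1%:R * (t *+ k) <= 1 ->
    `|fdiff k t (fun u => F (b u + u ^+ e *: w))| <= N.+1%:R ^+ k.+1 * (t *+ k) ^+ k.
Proof.
pose I N := {p : nat * R | (0 < p.2) && (N.+1%:R * (p.2 *+ p.1) <= 1)}.
pose g N (p : I N) w := fdiff (sval p).1 (sval p).2 (fun u => F (b u + u ^+ e *: w)).
pose B N (p : I N) : R := N.+1%:R ^+ (sval p).1.+1 * ((sval p).2 *+ (sval p).1) ^+ (sval p).1.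
pose A N := [set v | `|v| <= M /\ forall p, `|g N p v| <= B N p].
have Acl N : closed (A N).
  apply: closed_bounded_family => -[[k t] /= kt] v vM; have /andP[t0 tN] := kt.
  apply: fdiff_continuous => i ik.
  have ti0 : 0 <= t *+ i by rewrite mulrn_wge0 // ltW.
  have ti1 : t *+ i <= 1.
    rewrite -(ger0_norm ti0) (le_trans (natmul_le (ltW t0) ik)) // (le_trans _ tN) //.
    by rewrite ler_peMl ?ler1n // mulrn_wge0 // ltW.
  have Up : U (b (t *+ i) + (t *+ i) ^+ e *: v) by apply: bU; rewrite ?ti0.
  have [Fc _] := sF [::] Up.
  have Lc : {for v, continuous (fun w : 'rV[R]_n => b (t *+ i) + (t *+ i) ^+ e *: w)}.
    apply: (@cvgD _ _ _ (nbhs v) _ (fun=> b (t *+ i)) (fun w : 'rV[R]_n => (t *+ i) ^+ e *: w)).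
      exact: cvg_cst.
    by apply: cvgZr; exact: cvg_id.
  exact: (continuous_comp Lc Fc).
have Acov v : `|v| <= M -> exists N, A N v.
  move=> vM; have [[//|N] _ NP] := analytic1_fdiff (Fan vM).
  by exists N; split=> // -[[k t] /= kt]; have /andP[t0 tN] := kt; exact: NP.
have [N [v [r [r0 H]]]] := baire_ball M0 Acl Acov.
exists N, v, r; split=> // w wv k t t0 tN.
have [_ Hw] := H w wv.
have p0 : (0 < (k, t).2) && (N.+1%:R * ((k, t).2 *+ (k, t).1) <= 1) by rewrite t0.
exact: (Hw (exist _ (k, t) p0)).
Qed.

(** Take the iterated difference in w of step r / j in the directions of a word s of
    length j, at the centre of the ball given by [uniform_fdiff]. It equals
    (u ^ e r / j) ^ j (d_s F)(xi) with xi tending to x, that is, L u ^ k + o(u ^ k)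
    with k = e j and L = (r / j) ^ j (d_s F)(x). On the other hand it is a
    combination with total weight 2 ^ j of the functions u |-> F (b u + u ^ e w),
    whose k-th differences are uniformly bounded; [fdiff_leading_coef] then bounds
    L. The power u ^ e puts the derivatives of order j in degree exactly e j, and
    this is why they can be read off from a degree that grows linearly with j. *)
Lemma cauchy_estimates : exists C L, [/\ 0 <= C, 0 <= L &
  forall s, `|iter_partial s F x| <= C * (L * (size s)%:R) ^+ size s].
Proof.
have [N [v [r [r0 NP]]]] := uniform_fdiff.
set N1 : R := N.+1%:R in NP.
have N10 : 0 < N1 by rewrite ltr0n.
(* 4 comes from k ^ k <= 4 ^ k k!, 2 from the weights of the j differences. *)
pose L := 2 * (4 * N1) ^+ e / r.
have L0 : 0 <= L by rewrite /L divr_ge0 ?(ltW r0) // mulr_ge0 // exprn_ge0 // mulr_ge0 // ltW.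
exists (N1 + `|F x|), L; split=> //; first by rewrite addr_ge0 // ltW.
move=> s'; rewrite -[s']revK; move: (rev s') => s {s'}; rewrite size_rev.
case: (posnP (size s)) => [/size0nil -> /=|s0].
  by rewrite expr0 mulr1 lerDr ltW.
set j := size s in s0 *; pose k := (e * j)%N; pose h := r / j%:R.
have j0 : 0 < j%:R :> R by rewrite ltr0n.
have h0 : 0 < h by rewrite divr_gt0.
have hj : h *+ j = r by rewrite -mulr_natr divfK ?gt_eqF.
have k0 : (0 < k)%N by rewrite muln_gt0 e0.
pose f u := diff_op h s (fun w => F (b u + u ^+ e *: w)) v.
have fk := @fdiff_leading_coef R k f (h ^+ j * iter_partial (rev s) F x)
  (2 ^+ j * (N1 ^+ k.+1 * k%:R ^+ k)).
have {}fk : `|h ^+ j * iter_partial (rev s) F x| * k`!%:R <= 2 ^+ j * (N1 ^+ k.+1 * k%:R ^+ k).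
  apply: fk => [d d0|].
    have hj0 : 0 < h ^+ j by rewrite exprn_gt0.
    have [Gc _] := sF (rev s) Ux.
    have /nbhs_ballP[q /= q0 Gq] : \forall z \near x, U z /\
        `|iter_partial (rev s) F x - iter_partial (rev s) F z| < d / h ^+ j.
      near=> z; split; first by near: z; exact: open_nbhs_nbhs.
      by near: z; move/cvgrPdist_lt: Gc; apply; rewrite divr_gt0.
    have q20 : 0 < q / 2 by rewrite divr_gt0.
    have [q1 q10 bq] := bx q20.
    have D0 : 0 < `|v| + r by rewrite ltr_wpDl.
    pose q2 := q / 2 / (`|v| + r).
    have q2' : 0 < q2 by rewrite divr_gt0.
    exists (Num.min 1 (Num.min q1 q2)); first by rewrite !lt_min ltr01 q10.
    move=> t /andP[t0]; rewrite !lt_min => /and3P[t1 tq1 tq2].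
    have te : t ^+ e <= t.
      by rewrite -(prednK e0) exprS ler_piMr // exprn_ile1 // ltW.
    have te0 : 0 <= t ^+ e by rewrite exprn_ge0.
    have near_x z : `|z - (b t + t ^+ e *: v)| <= (t ^+ e * h) *+ j -> `|x - z| < q.
      rewrite -mulrnAr hj => zb; rewrite distrC.
      have -> : z - x = (b t - x) + (t ^+ e *: v + (z - (b t + t ^+ e *: v))).
        by rewrite -subr_shift [RHS]addrC subrKA.
      rewrite (le_lt_trans (ler_normD _ _)) // [q]splitr ltr_leD ?bq ?t0 //.
      rewrite (le_trans (ler_normD _ _)) // normrZ (ger0_norm te0).
      rewrite (le_trans (lerD (lexx _) zb)) // -mulrDr.
      rewrite (le_trans (ler_wpM2r (ltW D0) te)) // -ler_pdivlMr //; exact: ltW.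
    rewrite /f diff_op_affine.
    have Uz z : `|z - (b t + t ^+ e *: v)| <= (t ^+ e * h) *+ j -> U z.
      by move=> /near_x zx; have [] := Gq z; rewrite -?ball_normE.
    have [z zb zE] := @diff_op_mvt _ _ U F (t ^+ e * h) s [::] _ sF (mulr_ge0 te0 (ltW h0)) Uz.
    rewrite [X in `|X - _|]zE -/(rev s) -/j exprMn -exprM -/k.
    have [_ Gz] : U z /\ `|iter_partial (rev s) F x - iter_partial (rev s) F z| < d / h ^+ j.
      by apply: Gq; rewrite -ball_normE; exact: near_x.
    set Dz := iter_partial (rev s) F z in Gz *; set Dx := iter_partial (rev s) F x in Gz *.
    have -> : t ^+ k * h ^+ j * Dz - h ^+ j * Dx * t ^+ k = - (t ^+ k * (h ^+ j * (Dx - Dz))) by ring.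
    rewrite normrN normrM (ger0_norm (exprn_ge0 k t0)) mulrC ler_wpM2r ?exprn_ge0 //.
    by rewrite normrM (gtr0_norm hj0) mulrC -ler_pdivlMr // ltW.
  have k0' : 0 < k%:R :> R by rewrite ltr0n.
  exists (N1 * k%:R)^-1; first by rewrite invr_gt0 mulr_gt0.
  move=> t /andP[t0 tN].
  have tN' : N1 * (t *+ k) <= 1.
    by rewrite -[t *+ k]mulr_natl mulrA -ler_pdivlMl ?mulr_gt0 // mulr1 ltW.
  have -> : fdiff k t f = diff_op h s (fun w => fdiff k t (fun u => F (b u + u ^+ e *: w))) v.
    by rewrite /fdiff /f -diff_op_sum.
  apply: (le_trans (diff_op_le (ltW h0) (B := N1 ^+ k.+1 * (t *+ k) ^+ k) _)).
    by move=> z; rewrite hj => zv; exact: NP.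
  by rewrite -[t *+ k]mulr_natl exprMn !mulrA.
have kf0 : 0 < k`!%:R :> R by rewrite ltr0n fact_gt0.
have hj0 : 0 < h ^+ j by rewrite exprn_gt0.
have kk : k%:R ^+ k <= 4 ^+ k * k`!%:R :> R.
  by rewrite -!natrX -natrM ler_nat expnn_le_fact.
have {}fk : `|iter_partial (rev s) F x| <= N1 * (L * j%:R) ^+ j.
  rewrite -(ler_pM2r kf0) -(ler_pM2l hj0) mulrA -{1}(gtr0_norm hj0) -normrM.
  apply: (le_trans fk).
  apply: (@le_trans _ _ (2 ^+ j * (N1 ^+ k.+1 * (4 ^+ k * k`!%:R)))).
    by rewrite !ler_wpM2l ?exprn_ge0 // ltW.
  have -> : L * j%:R = 2 * (4 * N1) ^+ e / h.
    by rewrite /L /h; field; rewrite !gt_eqF.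
  rewrite le_eqVlt; apply/orP; left; apply/eqP.
  have -> : (2 * (4 * N1) ^+ e / h) ^+ j = 2 ^+ j * (4 ^+ k * N1 ^+ k) / h ^+ j.
    by rewrite expr_div_n [in LHS]exprMn -exprM -/k [in LHS]exprMn.
  rewrite exprS; field.
  by rewrite gt_eqF.
rewrite (le_trans fk) // ler_wpM2r ?lerDl //.
by rewrite exprn_ge0 // mulr_ge0 // ltW.
Unshelve. all: by end_near. Qed.

End CauchyEstimates.
End Category.

(** * Smoothness of analytic functions *)

(** The remainder of order two of a power is dominated by the same remainder with
    all quantities replaced by their bounds. *)
Lemma expr_taylor2 (R : realType) (x t A s : R) k : `|x| <= A -> `|t| <= s -> 0 < s ->
  `|(x + t) ^+ k - x ^+ k - t * (k%:R * x ^+ k.-1)| <=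
  (t / s) ^+ 2 * ((A + s) ^+ k - A ^+ k - k%:R * A ^+ k.-1 * s).
Proof.
move=> xA ts s0; have A0 : 0 <= A by exact: le_trans xA.
elim: k => [|k IH].
  by rewrite !expr0 !mul0r mulr0 !subr0 !subrr normr0 mulr0.
case: k IH => [_|k IH].
  by rewrite /= !expr1 !expr0 !mul1r !mulr1 [_ + t]addrC [_ + s]addrC !addrK !subrr normr0 mulr0.
set E := (X in `|X| <= _) in IH; set B := (X in _ * X) in IH.
have -> : (x + t) ^+ k.+2 - x ^+ k.+2 - t * (k.+2%:R * x ^+ k.+1) =
    (x + t) * E + k.+1%:R * x ^+ k * t ^+ 2.
  by rewrite /E /= -(natr1 k.+1) !exprS; ring.
have -> : (A + s) ^+ k.+2 - A ^+ k.+2 - k.+2%:R * A ^+ k.+1 * s =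
    (A + s) * B + k.+1%:R * A ^+ k * s ^+ 2.
  by rewrite /B /= -(natr1 k.+1) !exprS; ring.
rewrite (le_trans (ler_normD _ _)) // [leRHS]mulrDr lerD //.
  rewrite normrM mulrCA ler_pM // (le_trans (ler_normD _ _)) // lerD //.
rewrite !normrM normr_nat !normrX -[X in _ * X <= _]expr2 real_normK ?num_real //.
have -> : (t / s) ^+ 2 * (k.+1%:R * A ^+ k * s ^+ 2) = k.+1%:R * A ^+ k * t ^+ 2.
  by field; rewrite gt_eqF.
by rewrite ler_wpM2r ?sqr_ge0 // ler_wpM2l // lerXn2r.
Qed.

Lemma expr_bernoulli (R : realType) (A s : R) k : 0 <= A -> 0 < s ->
  A ^+ k + k%:R * A ^+ k.-1 * s <= (A + s) ^+ k.
Proof.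
move=> A0 s0; have As : `|A| <= A by rewrite ger0_norm.
have ss : `|s| <= s by rewrite gtr0_norm.
have := expr_taylor2 k As ss s0; rewrite divff ?gt_eqF // expr1n mul1r.
by move=> /(le_trans (normr_ge0 _)); rewrite subr_ge0 lerBrDr addrC.
Qed.

Lemma continuous_at_dist (R : realType) (T : topologicalType) (f : T -> R) (a : T) :
  (forall e, 0 < e -> \forall x \near a, `|f a - f x| < e) -> {for a, continuous f}.
Proof. by move=> fa; apply/cvgrPdist_lt. Qed.

Section TermwiseDerivative.
Context {R : realType} {n : nat}.
Implicit Types (F : 'rV[R]_n -> R) (a z : 'rV[R]_n) (p : mpoly n R) (m : multinom n).
Notation e_ i := (delta_mx 0 i : 'rV[R]_n).

Lemma ev_mderiv i z p : ev z (mderiv i p) =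
  \sum_(m <- msupp p) (m i)%:R * mcoeff m p * monom (mnm_sub m (mnm1 i)) z.
Proof. by rewrite /mderiv ev_sum; apply: eq_bigr => m _; rewrite evZ evX. Qed.

Lemma monom_taylor2 i m z (t s r : R) : `|z| + s <= r -> `|t| <= s -> 0 < s ->
  `|monom m (z + t *: e_ i) - monom m z - t * ((m i)%:R * monom (mnm_sub m (mnm1 i)) z)| <=
  (t / s) ^+ 2 * r ^+ mdeg m.
Proof.
move=> zsr ts s0; have z0 := normr_ge0 z.
pose q := \prod_(j < n | j != i) z 0 j ^+ m j.
have mE w : monom m w = w 0 i ^+ m i * \prod_(j < n | j != i) w 0 j ^+ m j.
  by rewrite /monom (bigD1 i).
have -> : monom m (z + t *: e_ i) = (z 0 i + t) ^+ m i * q.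
  rewrite mE !mxE !eqxx mulr1; congr (_ * _); apply: eq_bigr => j ji.
  by rewrite !mxE (negbTE ji) mulr0 addr0.
have -> : (m i)%:R * monom (mnm_sub m (mnm1 i)) z = (m i)%:R * z 0 i ^+ (m i).-1 * q.
  rewrite -mulrA /monom (bigD1 i) //=; congr (_ * (_ * _)).
    by rewrite mnmBE mnm1E eqxx subn1.
  by apply: eq_bigr => j ji; rewrite mnmBE mnm1E eq_sym (negbTE ji) subn0.
rewrite mE -/q.
have -> : (z 0 i + t) ^+ m i * q - z 0 i ^+ m i * q - t * ((m i)%:R * z 0 i ^+ (m i).-1 * q) =
  ((z 0 i + t) ^+ m i - z 0 i ^+ m i - t * ((m i)%:R * z 0 i ^+ (m i).-1)) * q by ring.
rewrite normrM; have r0 : 0 <= r by lra.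
have zi := expr_taylor2 (m i) (norm_coord_le z i) ts s0.
have qr : `|q| <= \prod_(j < n | j != i) r ^+ m j.
  rewrite normr_prod; apply: ler_prod => j _; rewrite normr_ge0 normrX lerXn2r ?nnegrE //.
  by rewrite (le_trans (norm_coord_le _ _)) //; lra.
rewrite mdegE -prodrXr (bigD1 i) //= [leRHS]mulrA ler_pM // (le_trans zi) //.
rewrite ler_wpM2l ?sqr_ge0 // (@le_trans _ _ ((`|z| + s) ^+ m i)) //.
  by rewrite -addrA -opprD lerBlDr lerDl addr_ge0 ?exprn_ge0 // !mulr_ge0 ?exprn_ge0 // ltW.
by rewrite lerXn2r ?nnegrE // addr_ge0 // ltW.
Qed.

Lemma ev_taylor2 i p z (t s r : R) : `|z| + s <= r -> `|t| <= s -> 0 < s ->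
  `|ev (z + t *: e_ i) p - ev z p - t * ev z (mderiv i p)| <= (t / s) ^+ 2 * pnorm r p.
Proof.
move=> zsr ts s0; rewrite ev_mderiv !evE mulr_sumr -!sumrB /pnorm mulr_sumr.
rewrite (le_trans (ler_norm_sum _ _ _)) //; apply: ler_sum => m _.
have -> : mcoeff m p * monom m (z + t *: e_ i) - mcoeff m p * monom m z -
    t * ((m i)%:R * mcoeff m p * monom (mnm_sub m (mnm1 i)) z) =
  mcoeff m p * (monom m (z + t *: e_ i) - monom m z -
     t * ((m i)%:R * monom (mnm_sub m (mnm1 i)) z)) by ring.
by rewrite normrM [leRHS]mulrCA ler_wpM2l // monom_taylor2.
Qed.

Lemma pnorm_mderiv i p (s r : R) : 0 <= s -> s < r ->
  pnorm s (mderiv i p) <= pnorm r p / (r - s).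
Proof.
move=> s0 sr; have rs : 0 < r - s by rewrite subr_gt0.
rewrite /mderiv (le_trans (pnorm_sum _ _ _ s0)) // /pnorm mulr_suml.
apply: ler_sum => m _; rewrite -/(pnorm _ _) pnormZ pnormX normrM normr_nat.
rewrite [_ * `|_|]mulrC -!mulrA ler_wpM2l // ler_pdivlMr //.
have := expr_bernoulli (mdeg m) s0 rs; rewrite addrC subrKC.
apply: le_trans; rewrite -[leLHS]addr0 lerD ?exprn_ge0 //.
rewrite ler_wpM2r ?(ltW rs) //; case: (posnP (m i)) => [->|mi].
  by rewrite mul0r mulr_ge0 ?exprn_ge0.
have mim : (m i <= mdeg m)%N by rewrite mdegE (bigD1 i) //= leq_addr.
have dE : mdeg (mnm_sub m (mnm1 i)) = (mdeg m).-1.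
  have : mdeg (mnm_add (mnm_sub m (mnm1 i)) (mnm1 i)) = mdeg m.
    congr mdeg; apply/mnmP => j; rewrite mnmDE mnmBE mnm1E.
    by case: eqP => [<-|_]; lia.
  by rewrite mdegD mdeg1; lia.
by rewrite dE ler_wpM2r ?exprn_ge0 // ler_nat.
Qed.

(** Normal convergence on a larger ball bounds the second order remainders of all
    the P j at once, so the sum may be differentiated term by term. *)
Lemma normal_expansion_derive i r C P a F : 0 < r -> normal_expansion r C P a F ->
  (forall z, `|z| <= r / 2 -> derivable F (a + z) (e_ i)) /\
  normal_expansion (r / 2) (C / (r / 2)) (fun j => mderiv i (P j)) a (fun x => 'D_(e_ i) F x).
Proof.
move=> r0 nF; have C0 := normal_expansion_ge0 (ltW r0) nF; have [PC FP] := nF.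
pose s := r / 2; have s0 : 0 < s by rewrite divr_gt0.
have rs : r - s = s by rewrite /s; lra.
have sr : s < r by rewrite /s; lra.
have PC' j : pnorm s (mderiv i (P j)) <= (C / s) / 2 ^+ j.
  rewrite (le_trans (pnorm_mderiv _ _ (ltW s0) sr)) // rs mulrAC ler_wpM2r ?PC //.
  by rewrite invr_ge0 ltW.
have der z : `|z| <= s -> exists d, is_derive (a + z) (e_ i) F d /\
    forall N, `|d - \sum_(j < N) ev z (mderiv i (P j))| <= 2 * (C / s) / 2 ^+ N.
  move=> zs; have uC j : `|ev z (mderiv i (P j))| <= (C / s) / 2 ^+ j.
    exact: le_trans (ev_le _ zs) (PC' j).
  have [d dP] := geometric_sum_ex uC; exists d; split=> //.
  have zr : `|z| <= r by rewrite (le_trans zs) // ltW.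
  have quad (t : R) : `|t| <= s -> `|F (a + z + t *: e_ i) - F (a + z) - t * d| <=
      (t / s) ^+ 2 * (2 * C).
    move=> ts; apply/ler_addgt0Pr => e e0.
    have ztr : `|z + t *: e_ i| <= r.
      rewrite (le_trans (ler_normD _ _)) // [r]splitr lerD //.
      exact: le_trans (norm_delta_scale _ _) ts.
    have [N NP] := half_lt_ex (2 * C + 2 * C + `|t| * (2 * (C / s))) e0.
    have h1 := FP _ ztr N; have h2 := FP _ zr N; have h3 := dP N.
    rewrite addrA in h1.
    set A1 := \sum_(j < N) _ in h1; set A2 := \sum_(j < N) _ in h2.
    set A3 := \sum_(j < N) _ in h3.
    have h4 : `|A1 - A2 - t * A3| <= (t / s) ^+ 2 * (2 * C).
      rewrite /A1 /A2 /A3 mulr_sumr -!sumrB (le_trans (ler_norm_sum _ _ _)) //.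
      apply: (@le_trans _ _ (\sum_(j < N) (t / s) ^+ 2 * (C / 2 ^+ (0 + j)))).
        apply: ler_sum => j _; rewrite (le_trans (@ev_taylor2 i (P j) z t s r _ ts s0)) //.
          by rewrite [leRHS]splitr lerD2r.
        by rewrite ler_wpM2l ?sqr_ge0 // PC.
      rewrite -mulr_sumr ler_wpM2l ?sqr_ge0 // (le_trans (sum_half_le _ _ C0)) //.
      by rewrite expr0 divr1.
    have -> : F (a + z + t *: e_ i) - F (a + z) - t * d =
      (A1 - A2 - t * A3) + ((F (a + z + t *: e_ i) - A1) - (F (a + z) - A2) - t * (d - A3)) by ring.
    rewrite (le_trans (ler_normD _ _)) // lerD // (le_trans _ (ltW NP)) //.
    rewrite (le_trans (ler_normB _ _)) // (mulrDl (2 * C + 2 * C)) (mulrDl (2 * C)) lerD //.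
      by rewrite (le_trans (ler_normB _ _)) // lerD.
    by rewrite normrM -mulrA ler_wpM2l.
  apply: is_derive_le => e e0.
  pose q := (2 * C) / s ^+ 2 + 1.
  have q0 : 0 < q by rewrite ltr_wpDl // divr_ge0 ?sqr_ge0 // mulr_ge0.
  exists (Num.min s (e / q)); first by rewrite lt_min s0 divr_gt0.
  move=> t; rewrite lt_min => /andP[ts]; rewrite ltr_pdivlMr // => tq.
  rewrite (le_trans (quad t (ltW ts))) //.
  have -> : (t / s) ^+ 2 * (2 * C) = (`|t| * (2 * C / s ^+ 2)) * `|t|.
    have tt : `|t| * `|t| = t ^+ 2 by rewrite -normrM -expr2 ger0_norm ?sqr_ge0.
    by rewrite [RHS]mulrAC tt; field; rewrite gt_eqF.
  rewrite ler_wpM2r // (le_trans _ (ltW tq)) // ler_wpM2l // lerDl.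
  exact: ler01.
split=> [z /der[d [[]]] //|]; split=> // z zs N.
by have [d [[_ ->]]] := der z zs.
Qed.

Lemma real_analytic_partial i F a : real_analytic_at F a ->
  derivable F a (e_ i) /\ real_analytic_at (fun x => 'D_(e_ i) F x) a.
Proof.
move=> /real_analytic_normal[r [C [P [r0 /(normal_expansion_derive i r0)[Fd FP]]]]].
have r20 : 0 < r / 2 by rewrite divr_gt0.
split; last exact: normal_real_analytic FP.
by have := Fd 0; rewrite addr0; apply; rewrite normr0 ltW.
Qed.

Lemma real_analytic_continuous F a : real_analytic_at F a -> {for a, continuous F}.
Proof.
move=> /real_analytic_homogeneous[r [C [P [r0 [PC Phom FP]]]]].
have C0 : 0 <= C.
  by have := PC 0%N r (ltW r0); rewrite expr0 mulr1; apply: le_trans; rewrite pnorm_ge0 ?ltW.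
have Pc z : ev z (P 0%N) = ev 0 (P 0%N).
  by have := Phom 0%N 0 z; rewrite scale0r expr0 mul1r.
have h z : `|z| <= r -> `|F (a + z) - ev 0 (P 0%N)| <= C * (`|z| / r).
  by move=> zr; have := FP z zr 1%N; rewrite big_ord1 Pc expr1.
have Fa : F a = ev 0 (P 0%N).
  have := h 0; rewrite addr0 normr0 mul0r mulr0 => /(_ (ltW r0)).
  by rewrite normr_le0 subr_eq0 => /eqP.
apply: continuous_at_dist => e e0; apply/nbhs_ballP.
have m0 : 0 < Num.min r (e / (C / r + 1)).
  by rewrite lt_min r0 divr_gt0 // ltr_wpDl // divr_ge0 // ltW.
exists (Num.min r (e / (C / r + 1))) => // w; rewrite -ball_normE /ball_ /= distrC.
rewrite lt_min => /andP[wr]; rewrite ltr_pdivlMr ?ltr_wpDl ?divr_ge0 ?(ltW r0) // => we.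
have := h (w - a) (ltW wr); rewrite [a + _]addrC subrK -Fa distrC => /le_lt_trans; apply.
apply: le_lt_trans we; rewrite mulrCA ler_wpM2l // lerDl; exact: ler01.
Qed.

Lemma real_analytic_smooth U F : open U -> real_analytic_on U F -> smooth_on U F.
Proof.
move=> oU FU s.
have Fs : real_analytic_on U (iter_partial s F).
  by elim: s => [//|i s IH] a Ua /=; have [] := real_analytic_partial i (IH a Ua).
move=> x Ux; split; first exact: real_analytic_continuous (Fs x Ux).
by move=> i; have [] := real_analytic_partial i (Fs x Ux).
Qed.

End TermwiseDerivative.

(** * Polynomial curves in UPC sets *)

Section CuspCurves.
Context {R : realType} {n : nat}.
Implicit Types (X : set 'rV[R]_n) (x y z v w : 'rV[R]_n) (t : R).

Lemma euclidean_norm_le w : euclidean_norm w <= n.+1%:R * `|w|.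
Proof.
have c0 : 0 <= n.+1%:R * `|w| by rewrite mulr_ge0.
rewrite -[leRHS](ger0_norm c0) -sqrtr_sqr ler_sqrt ?sqr_ge0 //.
apply: (@le_trans _ _ (\sum_(i < n) `|w| ^+ 2)).
  apply: ler_sum => i _; rewrite -real_normK ?num_real // lerXn2r ?nnegrE //.
  exact: norm_coord_le.
rewrite sumr_const card_ord -[_ *+ n]mulr_natl exprMn ler_wpM2r ?exprn_ge0 //.
by rewrite expr2 -natrM ler_nat; lia.
Qed.

Lemma euclidean_dist_mem X y z (c : R) : (c%:E <= euclidean_dist y (~` X))%E ->
  euclidean_norm (y - z) < c -> X z.
Proof.
move=> cd yz; apply: contrapT => Xz.
have : (euclidean_dist y (~` X) <= (euclidean_norm (y - z))%:E)%E.
  by apply: ereal_inf_lbound; exists z.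
by move=> /(le_trans cd); rewrite lee_fin leNgt yz.
Qed.

Lemma horner_lipschitz0 (p : {poly R}) : exists2 A, 0 <= A &
  forall t, `|t| <= 1 -> `|p.[t] - p.[0]| <= A * `|t|.
Proof.
have bnd (q : {poly R}) t : `|t| <= 1 -> `|q.[t]| <= \sum_(k < size q) `|q`_k|.
  move=> t1; rewrite horner_coef (le_trans (ler_norm_sum _ _ _)) //.
  apply: ler_sum => k _; rewrite normrM normrX ler_piMr // exprn_ile1 //.
elim/poly_ind: p => [|p c _].
  by exists 0 => // t _; rewrite !horner0 subrr normr0 mul0r.
exists (\sum_(k < size p) `|p`_k|); first exact: sumr_ge0.
move=> t t1; have -> : (p * 'X + c%:P).[t] - (p * 'X + c%:P).[0] = p.[t] * t.
  by rewrite !hornerE; ring.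
by rewrite normrM ler_wpM2r // bnd.
Qed.

Lemma poly_curve_lipschitz0 (h : 'I_n -> {poly R}) : exists2 A, 0 <= A &
  forall t, `|t| <= 1 -> `|poly_curve h t - poly_curve h 0| <= A * `|t|.
Proof.
have /choice[A AP] : forall i, exists A, 0 <= A /\
    forall t, `|t| <= 1 -> `|(h i).[t] - (h i).[0]| <= A * `|t|.
  by move=> i; have [A] := horner_lipschitz0 (h i); exists A.
exists (\sum_i A i); first by apply: sumr_ge0 => i _; have [] := AP i.
move=> t t1; apply: norm_le_coord => [|i].
  by rewrite mulr_ge0 // sumr_ge0 // => i _; have [] := AP i.
rewrite !mxE; have [_ /(_ t t1)] := AP i; move=> /le_trans; apply.
rewrite ler_wpM2r // (bigD1 i) //= lerDl sumr_ge0 // => j _; by have [] := AP j.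
Qed.

Definition cusp_curve (h : 'I_n -> {poly R}) m v i : {poly R} :=
  h i \Po 'X^2 + v 0 i *: 'X^(2 * m).

Lemma cusp_curveE h m v t :
  poly_curve (cusp_curve h m v) t = poly_curve h (t ^+ 2) + t ^+ (2 * m) *: v.
Proof.
apply/rowP => i; rewrite !mxE /cusp_curve hornerD horner_comp hornerZ !hornerXn.
by rewrite mulrC.
Qed.

Lemma size_cusp_curve (h : 'I_n -> {poly R}) m D v i : (size (h i) <= D.+1)%N ->
  (size (cusp_curve h m v i) <= (2 * maxn m D).+1)%N.
Proof.
move=> hD; rewrite (leq_trans (size_polyD _ _)) // geq_max; apply/andP; split.
  rewrite (leq_trans (size_comp_poly_leq _ _)) // size_polyXn /= ltnS mulnC leq_mul2l /=.
  rewrite (leq_trans _ (leq_maxr m D)) //; by case: (size (h i)) hD.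
by rewrite (leq_trans (size_scale_leq _ _)) // size_polyXn ltnS leq_mul2l /= leq_maxl.
Qed.

(** The curve h leaves x so that h (t ^ 2) is at distance at least M t ^ (2 m) from the
    complement. Squaring the parameter makes this hold on both sides of t = 0, and
    the curve may then be perturbed by t ^ (2 m) v with v in a fixed ball. This is
    where the degree 2 max (m, D) comes from. *)
Lemma char_cusp_curve X m D x : char X (m, D) -> X x ->
  exists (h : 'I_n -> {poly R}) e, [/\ 0 < e, forall i, (size (h i) <= D.+1)%N, poly_curve h 0 = x,
    (forall v t, `|v| <= e -> `|t| <= 1 -> X (poly_curve (cusp_curve h m v) t)) &
    forall t w, 0 < `|t| <= 1 ->
      `|w - poly_curve h (t ^+ 2)| <= t ^+ (2 * m) * e -> (interior X) w].
Proof.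
move=> [/= m0 D0 [M M0 /(_ x) H]] Xx; have [h [hD hx hX]] := H Xx.
pose e := M / (2 * n.+1%:R); have e0 : 0 < e by rewrite divr_gt0 // mulr_gt0.
suff hint t w : 0 < `|t| <= 1 -> `|w - poly_curve h (t ^+ 2)| <= t ^+ (2 * m) * e ->
    (interior X) w.
  exists h, e; split=> // v t ve t1; have [->|t0] := eqVneq t 0.
    by rewrite cusp_curveE !expr0n muln_eq0 /= (gtn_eqF m0) scale0r addr0 hx.
  apply: interior_subset; apply: (hint t); first by rewrite normr_gt0 t0.
  rewrite cusp_curveE [poly_curve _ _ + _]addrC addrK normrZ.
  by rewrite ger0_norm ?ler_wpM2l // exprM exprn_ge0 // sqr_ge0.
move=> /andP[t0 t1] wt; rewrite /interior.
have tm0 : 0 < t ^+ (2 * m) by rewrite exprM exprn_gt0 // exprn_even_gt0 // -normr_gt0.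
have r0 : 0 < t ^+ (2 * m) * e by rewrite mulr_gt0.
apply/nbhs_ballP; exists (t ^+ (2 * m) * e) => // z.
rewrite -ball_normE /ball_ /= => wz.
have t2 : t ^+ 2 \in `[0, 1].
  rewrite in_itv /= sqr_ge0 /= -real_normK ?num_real // exprn_ile1 //.
apply: euclidean_dist_mem (hX _ t2) _.
rewrite (le_lt_trans (euclidean_norm_le _)) // -ltr_pdivlMl //.
have -> : poly_curve h (t ^+ 2) - z = (w - z) - (w - poly_curve h (t ^+ 2)).
  by rewrite opprB [RHS]addrC subrKA.
rewrite (le_lt_trans (ler_normB _ _)) //.
have -> : n.+1%:R^-1 * (M * t ^+ 2 ^+ m) =
    t ^+ (2 * m) * e + t ^+ (2 * m) * e.
  by rewrite -exprM /e; field; rewrite nat1r pnatr_eq0.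
by rewrite ltr_leD.
Qed.

End CuspCurves.

(** * Identity principle along segments *)

Section Segments.
Context {R : realType} {n : nat}.
Implicit Types (G : 'rV[R]_n -> R) (x y z v w : 'rV[R]_n) (t : R).

Definition line_curve w0 w i : {poly R} := (w0 0 i)%:P + (w 0 i - w0 0 i) *: 'X.

Lemma line_curveE w0 w t : poly_curve (line_curve w0 w) t = w0 + t *: (w - w0).
Proof. by apply/rowP => i; rewrite !mxE /line_curve !hornerE mulrC. Qed.

Lemma size_line_curve w0 w i : (size (line_curve w0 w i) <= 2)%N.
Proof.
rewrite (leq_trans (size_polyD _ _)) // geq_max (leq_trans (size_polyC_leq1 _)) //=.
by rewrite (leq_trans (size_scale_leq _ _)) // size_polyX.
Qed.

Lemma line_curve_ball y w0 w t (r : R) : 0 <= t <= 1 -> `|w0 - y| < r -> `|w - y| < r ->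
  `|poly_curve (line_curve w0 w) t - y| < r.
Proof.
move=> /andP[t0 t1] h0 h1; rewrite line_curveE.
have -> : w0 + t *: (w - w0) - y = (1 - t) *: (w0 - y) + t *: (w - y).
  rewrite scalerBl scale1r -addrA addrAC; apply/rowP => i; rewrite !mxE; ring.
rewrite (le_lt_trans (ler_normD _ _)) // !normrZ (ger0_norm t0) ger0_norm ?subr_ge0 //.
have [->|tp] := eqVneq t 0; first by rewrite subr0 mul1r mul0r addr0.
have {}tp : 0 < t by rewrite lt_def tp.
apply: (@lt_le_trans _ _ ((1 - t) * r + t * r)); last by rewrite -mulrDl subrK mul1r.
by rewrite ler_ltD ?ltr_pM2l // ler_wpM2l ?subr_ge0 // ltW.
Qed.

(** Analyticity along the segment from w0 to w suffices, and this is all that is known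
    of F in the interior of X. *)
Lemma vanish_along_segment G w0 w (e : R) : 0 < e ->
  (forall t, 0 <= t <= 1 -> analytic1 (fun s => G (poly_curve (line_curve w0 w) s)) t) ->
  (forall z, `|z - w0| < e -> G z = 0) -> G w = 0.
Proof.
move=> e0 Ga Gz.
have := identity_segment Ga; rewrite line_curveE scale1r addrC subrK; apply.
have d0 : 0 < `|w - w0| + 1 by rewrite ltr_wpDl.
exists (e / (`|w - w0| + 1)); first by rewrite divr_gt0.
move=> t /andP[t0]; rewrite ltr_pdivlMr // => te; apply: Gz.
rewrite line_curveE [w0 + _]addrC addrK normrZ ger0_norm // (le_lt_trans _ te) //.
by rewrite ler_wpM2l // lerDl.
Qed.

End Segments.

Lemma analytic1_scale (R : realType) (f : R -> R) (c t : R) : 0 < c ->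
  analytic1 f (c * t) -> analytic1 (fun s => f (c * s)) t.
Proof.
move=> c0 [r [C [b [r0 fb]]]].
exists (r / c), C, (fun k => b k * c ^+ k); split; first by rewrite divr_gt0.
move=> h hr N; have ch : `|c * h| <= r.
  by rewrite normrM gtr0_norm // mulrC -ler_pdivlMr.
have := fb (c * h) ch N; rewrite -mulrDr normrM (gtr0_norm c0).
have -> : c * `|h| / r = `|h| / (r / c) by field; rewrite !gt_eqF.
by under eq_bigr do rewrite exprMn mulrA.
Qed.

(** * Analytic extension *)

Section LocalExtension.
Context {R : realType} {n : nat}.
Variables (X : set 'rV[R]_n) (m D : nat).
Hypotheses (Xsimple : simple X) (Xchar : char X (m, D)).
Variables (f : X -> R) (U : set 'rV[R]_n) (F : 'rV[R]_n -> R).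
Hypotheses (fplot : plot_analytic 1 (2 * maxn m D) X f).
Hypotheses (oU : open U) (XU : X `<=` U) (sF : smooth_on U F).
Hypothesis Ff : forall z : X, F (val z) = f z.
Implicit Types (T : 'rV[R]_n -> R) (x y z v w : 'rV[R]_n) (t : R).

Let m0 : (0 < m)%N. Proof. by case: Xchar. Qed.

Let ballE x r z : ball x r z = (`|z - x| < r) :> Prop.
Proof. by rewrite -ball_normE /ball_ /= distrC. Qed.

Lemma analytic1_line w0 w t : (interior X) (poly_curve (line_curve w0 w) t) ->
  analytic1 (fun s => F (poly_curve (line_curve w0 w) s)) t.
Proof.
move=> Xt; apply: (analytic1_plot fplot Ff).
  move=> i; rewrite (leq_trans (size_line_curve _ _ _)) // ltnS.
  by rewrite (leq_trans _ (leq_pmulr 2 _)) // (leq_trans m0) // leq_maxl.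
have [e /= e0 Xe] := (nbhs_ballP _ _).1 Xt.
have [A A0 AP] := poly_curve_lipschitz0 (shift_curve (line_curve w0 w) t).
apply/nbhs_ballP.
have d0 : 0 < Num.min 1 (e / (A + 1)) by rewrite lt_min ltr01 divr_gt0 // ltr_wpDl.
exists (Num.min 1 (e / (A + 1))) => // s; rewrite -ball_normE /ball_ /= distrC lt_min.
move=> /andP[s1]; rewrite ltr_pdivlMr ?ltr_wpDl // => se; apply: Xe; rewrite ballE.
have := AP (s - t) (ltW s1); rewrite !shift_curveE addr0 [t + _]addrC subrK => /le_lt_trans; apply.
by rewrite (le_lt_trans _ se) // mulrC ler_wpM2l // lerDl.
Qed.

(** F is not known to be analytic at this stage; its analyticity along the segments
    contained in the interior of X is enough. *)
Lemma vanish_ball T y (r : R) w0 (e : R) : 0 < e ->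
  (forall z, `|z - y| < r -> real_analytic_at T z /\ (interior X) z) ->
  `|w0 - y| < r -> (forall z, `|z - w0| < e -> F z - T z = 0) ->
  forall w, `|w - y| < r -> F w - T w = 0.
Proof.
move=> e0 Tr w0y H0 w wy.
apply: (@vanish_along_segment _ _ (fun z => F z - T z) w0 w e e0 _ H0).
move=> t t01; have [Ta Xa] := Tr _ (line_curve_ball t01 w0y wy).
by apply: analytic1B; [exact: analytic1_line|exact: analytic1_curve].
Qed.

(** Cauchy estimates at x come from the cusp curves: they are plots of degree at
    most 2 max (m, D). *)
Lemma formal_extension x : X x -> exists r T,
  [/\ 0 < r, forall y, `|y - x| < r -> real_analytic_at T y &
      forall N, exists K e, 0 < e /\ forall z, `|z| < e -> `|F (x + z) - T (x + z)| <= K * `|z| ^+ N].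
Proof.
move=> Xx; have [h [e [e0 hD hx inX _]]] := char_cusp_curve Xchar Xx.
have [A A0 AP] := poly_curve_lipschitz0 h.
have [C [L [C0 L0 FC]]] : exists C L, [/\ 0 <= C, 0 <= L &
    forall s, `|iter_partial s F x| <= C * (L * (size s)%:R) ^+ size s].
  apply: (@cauchy_estimates R n U F x (fun t => poly_curve h (t ^+ 2)) (2 * m) e) => //.
  - exact: XU.
  - by rewrite muln_gt0.
  - move=> d d0; exists (Num.min 1 (d / (A + 1))).
      by rewrite lt_min ltr01 divr_gt0 // ltr_wpDl.
    move=> t /andP[t0]; rewrite lt_min => /andP[t1]; rewrite ltr_pdivlMr ?ltr_wpDl // => td.
    have tt : `|t ^+ 2| <= t by rewrite ger0_norm ?sqr_ge0 // expr2 ler_piMr // ltW.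
    rewrite -hx (le_lt_trans (AP _ _)) ?(le_trans tt) ?ltW // (le_lt_trans _ td) // mulrC.
    by rewrite ler_pM // lerDl.
  - move=> v t ve /andP[t0 t1]; rewrite -cusp_curveE; apply: XU; apply: inX => //.
    by rewrite ger0_norm.
  - move=> v ve.
    have -> : (fun t => F (poly_curve h (t ^+ 2) + t ^+ (2 * m) *: v)) =
        (fun t => F (poly_curve (cusp_curve h m v) t)).
      by apply/funext => t; rewrite cusp_curveE.
    apply: (analytic1_plot fplot Ff); first by move=> i; exact: size_cusp_curve.
    apply/nbhs_ballP; exists 1 => //= t; rewrite -ball_normE /ball_ /= sub0r normrN => /ltW.
    exact: inX.
have [r [T [r0 Tn TF]]] := taylor_series_ex C0 L0 FC.
exists r, T; split=> //; first by move=> y; exact: normal_expansion_ball Tn.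
move=> N; have [K1 [r1 [r10 H1]]] := taylor_remainder N oU sF (XU Xx).
have [K2 H2] := TF N.
exists (K1 + K2), (Num.min r r1); split; first by rewrite lt_min r0.
move=> z; rewrite lt_min => /andP[zr zr1].
have h1 := H1 z zr1; have h2 := H2 z (ltW zr).
set S := \sum_(j < N) _ in h1 h2.
have -> : F (x + z) - T (x + z) = (F (x + z) - S) - (T (x + z) - S) by ring.
by rewrite mulrDl (le_trans (ler_normB _ _)) // lerD.
Qed.

(** Along each cusp curve F - T is analytic, and it is flat at t = 0; hence it
    vanishes as long as the curve stays in the ball where T is analytic. For a fixed
    small t0 the points of these curves at time t0 fill a ball. *)
Lemma vanish_cusp x : X x -> exists (r : R) T,
  [/\ 0 < r, forall y, `|y - x| < r -> real_analytic_at T y &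
   forall d, 0 < d -> exists w0 e, [/\ 0 < e, `|w0 - x| < d, (interior X) w0 &
      forall z, `|z - w0| < e -> F z - T z = 0]].
Proof.
move=> Xx; have [r [T [r0 Ta Tflat]]] := formal_extension Xx.
exists r, T; split=> // d d0.
have [h [e [e0 hD hx inX hX]]] := char_cusp_curve Xchar Xx.
have [A A0 AP] := poly_curve_lipschitz0 h.
pose B := A + e + 1; have B0 : 0 < B by rewrite /B; lra.
have qle v t : `|v| <= e -> `|t| <= 1 -> `|poly_curve (cusp_curve h m v) t - x| <= B * `|t|.
  move=> ve t1; rewrite cusp_curveE -hx addrAC (le_trans (ler_normD _ _)) //.
  have tt : `|t ^+ 2| <= `|t| by rewrite normrX expr2 ler_piMr.
  rewrite /B mulrDl mul1r -[leLHS]addr0 lerD // mulrDl lerD //.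
    by rewrite (le_trans (AP _ (le_trans tt t1))) // ler_wpM2l.
  rewrite normrZ mulrC ler_pM // normrX -(prednK (_ : 0 < 2 * m)%N) ?muln_gt0 //.
  by rewrite exprS ler_piMr // exprn_ile1.
(* Up to time t0 all the curves stay within min r d of x. *)
pose t0 := Num.min (1 / 2) (Num.min r d / (2 * B)).
have rd0 : 0 < Num.min r d by rewrite lt_min r0.
have t00 : 0 < t0 by rewrite lt_min !divr_gt0 // mulr_gt0.
have t01 : t0 < 1 by rewrite gt_min; apply/orP; left; lra.
have tB : B * t0 < Num.min r d.
  rewrite (@le_lt_trans _ _ (Num.min r d / 2)) //; last by lra.
  rewrite mulrC -ler_pdivlMr // -mulrA -invfM ge_min lexx orbT //.
have t0n : 0 < `|t0| <= 1 by rewrite gtr0_norm // t00 ltW.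
have tm0 : 0 < t0 ^+ (2 * m) by rewrite exprn_gt0.
have small v s : `|v| <= e -> 0 <= s <= t0 ->
    `|poly_curve (cusp_curve h m v) s - x| < Num.min r d.
  move=> ve /andP[s0 st]; rewrite (le_lt_trans (qle _ _ ve _)) ?ger0_norm //.
    by rewrite (le_trans st) // ltW.
  by rewrite (le_lt_trans _ tB) // ler_pM2l.
exists (poly_curve h (t0 ^+ 2)), (t0 ^+ (2 * m) * e); split.
- by rewrite mulr_gt0.
- have := small 0 t0; rewrite normr0 ltW // (ltW t00) lexx cusp_curveE scaler0 addr0.
  by move=> /(_ isT isT); rewrite lt_min => /andP[].
- by apply: (hX t0) => //; rewrite subrr normr0 mulr_ge0 // ltW.
(* z lies on the cusp curve of direction v, at time t0. *)
move=> z ze; pose v := (t0 ^+ (2 * m))^-1 *: (z - poly_curve h (t0 ^+ 2)).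
have ve : `|v| <= e.
  rewrite /v normrZ gtr0_norm ?invr_gt0 // ler_pdivrMl //; exact: ltW.
have zE : z = poly_curve (cusp_curve h m v) (t0 * 1).
  rewrite mulr1 cusp_curveE /v scalerA divff ?gt_eqF // scale1r addrC subrK //.
pose phi s := F (poly_curve (cusp_curve h m v) s) - T (poly_curve (cusp_curve h m v) s).
have phia s : 0 <= s <= t0 -> analytic1 phi s.
  move=> st; have /andP[s0 s1] := st; apply: analytic1B; last first.
    apply: analytic1_curve; apply: Ta; have := small v s ve st.
    by rewrite lt_min => /andP[].
  apply: (analytic1_plot fplot Ff); first by move=> i; exact: size_cusp_curve.
  apply/nbhs_ballP; exists (1 - s) => /=; first by rewrite subr_gt0 (le_lt_trans s1).
  move=> u; rewrite -ball_normE /ball_ /= distrC => us.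
  apply: inX => //; rewrite -[u](subrK s) (le_trans (ler_normD _ _)) // (ger0_norm s0).
  by rewrite ltW // -ltrBrDr.
have phi0 : \forall s \near 0, phi s = 0.
  apply: analytic1_flat; first by apply: phia; rewrite lexx ltW.
  move=> N; have [K [e1 [e10 KP]]] := Tflat N.
  exists (`|K| * B ^+ N) => e2 e20; pose u := Num.min 1 (Num.min (e1 / (2 * B)) (e2 / 2)).
  have u0 : 0 < u by rewrite !lt_min ltr01 !divr_gt0 // mulr_gt0.
  have u1 : `|u| <= 1 by rewrite gtr0_norm // ge_min lexx.
  have ue2 : u < e2 by rewrite !gt_min; apply/orP; right; apply/orP; right; lra.
  have ue1 : B * u < e1.
    rewrite (@le_lt_trans _ _ (e1 / 2)) //; last by lra.
    by rewrite mulrC -ler_pdivlMr // -mulrA -invfM !ge_min lexx /= orbT.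
  exists u; rewrite gtr0_norm // u0 ue2; split=> //; rewrite add0r.
  have qx := qle v u ve u1; rewrite gtr0_norm // in qx.
  have := KP _ (le_lt_trans qx ue1); rewrite [x + _]addrC subrK => /le_trans; apply.
  rewrite -mulrA -exprMn (@le_trans _ _ (`|K| * `|poly_curve (cusp_curve h m v) u - x| ^+ N)) //.
    by rewrite ler_wpM2r ?ler_norm // exprn_ge0.
  by rewrite ler_wpM2l // lerXn2r ?nnegrE // mulr_ge0 // ltW.
have := @identity_segment R (fun s => phi (t0 * s)); rewrite zE; apply.
  move=> s /andP[s0 s1]; apply: analytic1_scale => //; apply: phia.
  by rewrite mulr_ge0 ?(ltW t00) //= ler_piMr // ltW.
have /nbhs_ballP[e1 /= e10 He] := phi0.
exists (e1 / t0); first by rewrite divr_gt0.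
move=> s /andP[s0]; rewrite ltr_pdivlMr // => se; apply: He.
by rewrite -ball_normE /ball_ /= sub0r normrN ger0_norm ?mulr_ge0 ?(ltW t00) // mulrC.
Qed.

(** F - T vanishes on a ball contained in the interior of X and as close to x as one
    wants. Simplicity of X spreads this to the whole interior of X near x, by
    connectedness, and density of the interior in X, which the cusp curves give
    at every point of X, spreads it to X. *)
Lemma local_extension x : X x -> exists (r : R) T,
  [/\ 0 < r, forall y, `|y - x| < r -> real_analytic_at T y &
   forall y, X y -> `|y - x| < r -> T y = F y].
Proof.
move=> Xx; have [r [T [r0 Ta Tv]]] := vanish_cusp Xx.
pose Z := [set w | F w - T w = 0].
have Zball y (e : R) : 0 < e -> (forall z, `|z - y| < e -> `|z - x| < r /\ (interior X) z) ->
    (exists2 w0, `|w0 - y| < e & (interior Z) w0) -> forall w, `|w - y| < e -> F w - T w = 0.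
  move=> e0 eX [w0 w0y /nbhs_ballP[e1 /= e10 Zw]].
  apply: (@vanish_ball T y e w0 e1 e10) => // [z /eX[zr Xz]|z zw]; first by split=> //; exact: Ta.
  by apply: Zw; rewrite ballE.
(* a neighbourhood of x on which F and T agree inside the interior of X *)
have [V [Vx Vr VZ]] : exists V : set 'rV[R]_n, [/\ nbhs x V, V `<=` ball x r &
    forall w, V w -> (interior X) w -> F w - T w = 0].
  have [xi|xi] := pselect ((interior X) x).
    have /nbhs_ballP[e /= e0 eX] : nbhs x (interior X `&` ball x r).
      apply: filterI; last exact: nbhsx_ballx.
      by apply: open_nbhs_nbhs; split=> //; exact: open_interior.
    exists (ball x e); split; first exact: nbhsx_ballx.
      by move=> w /eX[].
    move=> w; rewrite ballE => wx _; apply: (Zball x e e0) => // [z zx|].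
      have [Xz] : (interior X `&` ball x r) z by apply: eX; rewrite ballE.
      by rewrite ballE.
    have [w0 [e1 [e10 w0x _ w0Z]]] := Tv e e0; exists w0 => //.
    by apply/nbhs_ballP; exists e1 => // z; rewrite ballE; exact: w0Z.
  have bx : boundary X x by split=> //; exact: subset_closure.
  have [BB [BBnbhs BBbasis] BBconn] := Xsimple bx.
  have [V BV Vr] := BBbasis _ (nbhsx_ballx x r r0).
  exists V; split=> // [|w Vw Xw]; first exact: BBnbhs.
  have Vx := BBnbhs _ BV.
  suff : (V `&` interior X `&` interior Z) w by case=> _ /interior_subset.
  rewrite (BBconn V BV (V `&` interior X `&` interior Z)) //.
  - have /nbhs_ballP[e /= e0 eV] := Vx.
    have [w0 [e1 [e10 w0x Xw0 w0Z]]] := Tv e e0; exists w0; split.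
      by split=> //; apply: eV; rewrite ballE.
    by apply/nbhs_ballP; exists e1 => // z; rewrite ballE; exact: w0Z.
  - by exists (interior Z) => //; exact: open_interior.
  - exists (closure (V `&` interior X `&` interior Z)); first exact: closed_closure.
    apply/seteqP; split=> [y yVXZ|y [[Vy Xy] cly]].
      by split; [case: yVXZ|exact: subset_closure].
    split=> //; have /nbhs_ballP[e /= e0 eX] : nbhs y (interior X `&` ball x r).
      apply: filterI; first by apply: open_nbhs_nbhs; split=> //; exact: open_interior.
      by apply: open_nbhs_nbhs; split; [exact: ball_open|exact: Vr].
    have [w0 [[_ w0Z] w0y]] := cly _ (nbhsx_ballx y e e0).
    apply/nbhs_ballP; exists e => // z; rewrite ballE => zy.
    apply: (Zball y e e0) => // [u uy|]; last by exists w0; rewrite -?ballE.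
    have [Xu] : (interior X `&` ball x r) u by apply: eX; rewrite ballE.
    by rewrite ballE.
have /nbhs_ballP[r1 /= r10 r1V] : nbhs x (interior V).
  by apply: open_nbhs_nbhs; split; [exact: open_interior|exact: Vx].
exists r1, T; split=> // [y yx|y Xy yx].
  by apply: Ta; rewrite -ballE; apply: Vr; apply: interior_subset; apply: r1V; rewrite ballE.
have Vy : nbhs y V by apply: r1V; rewrite ballE.
have Tay : real_analytic_at T y.
  by apply: Ta; rewrite -ballE; apply: Vr; exact: nbhs_singleton Vy.
have Hc : {for y, continuous (fun z => F z - T z)}.
  have [Fc _] := sF [::] (XU Xy).
  apply: continuousB; first exact: Fc.
  exact: real_analytic_continuous.
apply/eqP; rewrite eq_sym -subr_eq0 -normr_le0 leNgt; apply/negP => H0.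
have /nbhs_ballP[e /= e0 eH] : \forall z \near y,
    V z /\ `|(F y - T y) - (F z - T z)| < `|F y - T y|.
  near=> z; split; first by near: z.
  by near: z; move/cvgrPdist_lt: Hc; apply.
have [r' [T' [_ _ Tv']]] := vanish_cusp Xy.
have [w0 [e' [_ w0y Xw0 _]]] := Tv' e e0.
have [Vw0] : V w0 /\ `|(F y - T y) - (F w0 - T w0)| < `|F y - T y|.
  by apply: eH; rewrite ballE.
by rewrite (VZ w0) // subr0 ltxx.
Unshelve. all: by end_near. Qed.

(** The local extensions are glued on balls of half the radius: if two such halves
    meet, the larger ball contains the centre of the smaller one, near which both
    extensions agree with F on an open set, and the intersection of the two balls is
    convex. *)
Lemma global_extension : exists V G,
  [/\ open V, X `<=` V, real_analytic_on V G & forall y, X y -> G y = F y].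
Proof.
have /choice[rT rTP] : forall x, exists rT : R * ('rV[R]_n -> R), X x ->
    [/\ 0 < rT.1, forall y, `|y - x| < rT.1 -> real_analytic_at rT.2 y &
     forall y, X y -> `|y - x| < rT.1 -> rT.2 y = F y].
  move=> x; have [Xx|nXx] := pselect (X x); last by exists (0, F).
  by have [r [T H]] := local_extension Xx; exists (r, T).
pose r x := (rT x).1; pose T x := (rT x).2.
have r0 x : X x -> 0 < r x by move=> /rTP[].
have Ta x y : X x -> `|y - x| < r x -> real_analytic_at (T x) y by move=> /rTP[_ + _]; exact.
have TF x y : X x -> X y -> `|y - x| < r x -> T x y = F y by move=> /rTP[_ _]; exact.
have agree_le x x' y : X x -> X x' -> r x' <= r x -> `|y - x| < r x / 2 ->
    `|y - x'| < r x' / 2 -> T x y = T x' y.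
  move=> Xx Xx' rr yx yx'.
  have x'x : `|x' - x| < r x.
    have -> : x' - x = (y - x) - (y - x') by rewrite opprB [RHS]addrC subrKA.
    by rewrite (le_lt_trans (ler_normB _ _)) //; lra.
  have e0 : 0 < Num.min (r x') (r x - `|x' - x|) by rewrite lt_min r0 //= subr_gt0.
  have [r'' [T'' [_ _ Tv'']]] := vanish_cusp Xx'.
  have [w0 [e2 [_ + Xw0 _]]] := Tv'' _ e0; rewrite lt_min => /andP[w0x' w0x].
  have {}w0x : `|w0 - x| < r x.
    have -> : w0 - x = (w0 - x') + (x' - x) by rewrite subrKA.
    by rewrite (le_lt_trans (ler_normD _ _)) // -ltrBrDr.
  have rx := r0 x Xx; have rx' := r0 x' Xx'.
  have {}yx : `|y - x| < r x by lra.
  have {}yx' : `|y - x'| < r x' by lra.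
  have /nbhs_ballP[e1 /= e10 H1] : nbhs w0 (interior X `&` (ball x (r x) `&` ball x' (r x'))).
    apply: filterI; first by apply: open_nbhs_nbhs; split=> //; exact: open_interior.
    by apply: open_nbhs_nbhs; split; [apply: openI; exact: ball_open|split; rewrite ballE].
  apply/eqP; rewrite -subr_eq0; apply/eqP.
  apply: (@vanish_along_segment _ _ (fun z => T x z - T x' z) w0 y e1 e10).
    move=> t t01; apply: analytic1B; apply: analytic1_curve.
      by apply: Ta => //; exact: line_curve_ball.
    by apply: Ta => //; exact: line_curve_ball.
  move=> z; rewrite -ballE => /H1[/interior_subset Xz []]; rewrite !ballE => zx zx'.
  by rewrite !TF // subrr.
have agree x x' y : X x -> X x' -> `|y - x| < r x / 2 -> `|y - x'| < r x' / 2 -> T x y = T x' y.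
  move=> Xx Xx' yx yx'; have [rr|/ltW rr] := leP (r x') (r x); first exact: agree_le.
  by apply/esym; exact: agree_le.
pose c y := xget y [set x | X x /\ `|y - x| < r x / 2].
have cP x y : X x -> `|y - x| < r x / 2 -> X (c y) /\ `|y - c y| < r (c y) / 2.
  by move=> Xx yx; rewrite /c; case: xgetP => [_ _ //|/(_ x)[]].
have nearE x y : X x -> `|y - x| < r x / 2 -> \forall z \near y, `|z - x| < r x / 2.
  move=> Xx yx; have : nbhs y (ball x (r x / 2)).
    by apply: open_nbhs_nbhs; split; [exact: ball_open|rewrite ballE].
  by apply: filterS => z; rewrite ballE.
exists [set y | exists2 x, X x & `|y - x| < r x / 2], (fun y => T (c y) y); split.
- rewrite openE => y [x Xx yx]; rewrite /interior.
  by apply: filterS (nearE x y Xx yx) => z zx; exists x.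
- by move=> x Xx; exists x => //; rewrite subrr normr0 divr_gt0 // r0.
- move=> y [x Xx yx]; apply: (@real_analytic_at_eq _ _ (T x)).
    apply: filterS (nearE x y Xx yx) => z zx; have [Xc zc] := cP x z Xx zx.
    exact: agree.
  by apply: Ta => //; have := r0 x Xx; lra.
- move=> y Xy; have yy : `|y - y| < r y / 2 by rewrite subrr normr0 divr_gt0 // r0.
  have [Xc yc] := cP y y Xy yy; rewrite TF //; have := r0 _ Xc; lra.
Qed.

End LocalExtension.

(** * The characterization *)

Lemma analytic_restr_plot (R : realType) n (X : set 'rV[R]_n) k d f :
  analytic_restr X f -> plot_analytic k d X f.
Proof.
move=> [U [F [oU XU FU Ff]]] p [_ pX].
exists (fun t => F (poly_map p t)).
  by apply: real_analytic_poly_map; apply: FU; apply: XU; exact: nbhs_singleton pX.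
by apply/nbhs_ballP; exists 1 => //= t _ z zt; rewrite -zt Ff.
Qed.

Lemma analytic_restr_smooth (R : realType) n (X : set 'rV[R]_n) f :
  analytic_restr X f -> smooth_restr X f.
Proof.
move=> [U [F [oU XU FU Ff]]]; exists U, F; split=> //; exact: real_analytic_smooth.
Qed.

Theorem theorem1p1 (R : realType) (n : nat) (X : set 'rV[R]_n)
    (X0 : X !=set0) (Xsimple : simple X) (Xclosed : closed X) (XUPC : UPC X) :
  plot_analytic 1 (d_of X) X `&` smooth_restr X = analytic_restr X.
Proof.
have [_ [mD0 char0]] := XUPC.
have [[[m D] Xchar dE] _] : [set maxn mD.1 mD.2 | mD in char X]
    (minimum [set maxn mD.1 mD.2 | mD in char X]) /\ True.
  by have [] := @minimumP [set maxn mD.1 mD.2 | mD in char X]; first by exists (maxn mD0.1 mD0.2), mD0.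
have {}dE : d_of X = (2 * maxn m D)%N by rewrite /d_of -dE.
apply/seteqP; split=> [f [fplot [U [F [oU XU sF Ff]]]]|f fa]; last first.
  by split; [exact: analytic_restr_plot|exact: analytic_restr_smooth].
rewrite dE in fplot.
have [V [G [oV XV GV GF]]] := global_extension Xsimple Xchar fplot oU XU sF Ff.
exists V, G; split=> // z; rewrite -Ff GF //; exact: set_mem (valP z).
Qed.
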